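(* Let $p$ be as in the context, fix positive $a_l,a_r$ and consider the Riemann problem with data $\bar u_l,\bar u_r\in A_0$. Define $$l'=\inf\left\{\rho\in[\hat\varphi_l(\bar u_l),\check\varphi_l(\bar u_l)]\colon a_l\,L_1(\rho;\bar u_l)\le a_r\,L_2^-(\hat\varphi_r(\bar u_r);\bar u_r)\right\},$$ $$l''=\sup\left\{\rho\in[\hat\varphi_l(\bar u_l),\check\varphi_l(\bar u_l)]\colon a_l\,L_1(\rho;\bar u_l)\ge a_r\,L_2^-(\check\varphi_r(\bar u_r);\bar u_r)\right\}.$$ A necessary and sufficient condition for the existence and uniqueness of a (P)-solution to the Riemann problem, attaining values in $A_0$, is $$\left\{\begin{array}{rcl} P\left(l',L_1(l';\bar u_l)\right)-P\left(g\left(\frac{a_l}{a_r}L_1(l';\bar u_l)\right),\frac{a_l}{a_r}L_1(l';\bar u_l)\right)&\le&0,\\[4pt] P\left(l'',L_1(l'';\bar u_l)\right)-P\left(g\left(\frac{a_l}{a_r}L_1(l'';\bar u_l)\right),\frac{a_l}{a_r}L_1(l'';\bar u_l)\right)&\ge&0, \end{array}\right.$$ where $g$ is the inverse in $A_0$ of the function $\rho\mapsto L_2^-(\rho;\bar u_r)$.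
   Context: Pressure: $p\in C^2(\mathbb{R}^+;\mathbb{R}^+)$, $\mathbb{R}^+=[0,+\infty[$, with $p'(\rho)>0$ and $p''(\rho)\ge0$ for all $\rho>0$. Write $u=(\rho,q)$, $c(\rho)=\sqrt{p'(\rho)}$, $P(u)=\frac{q^2}{\rho}+p(\rho)$, $\lambda_1(u)=\frac q\rho-c(\rho)$, $\lambda_2(u)=\frac q\rho+c(\rho)$. Subsonic region: $A_0=\{u\in\,]0,+\infty[\times\mathbb{R}\colon\lambda_1(u)<0<\lambda_2(u)\}$. Lax curves, for $u_o=(\rho_o,q_o)$ with $\rho_o>0$: the forward 1-Lax curve is $L_1(\rho;u_o)=\frac{\rho}{\rho_o}q_o-\rho\int_{\rho_o}^\rho\frac{c(r)}r\,dr$ if $\rho\le\rho_o$, and $L_1(\rho;u_o)=\frac{\rho}{\rho_o}q_o-\sqrt{\frac\rho{\rho_o}(\rho-\rho_o)(p(\rho)-p(\rho_o))}$ if $\rho\ge\rho_o$. The reversed 2-Lax curve is $L_2^-(\rho;u_o)=\frac{\rho}{\rho_o}q_o+\rho\int_{\rho_o}^\rho\frac{c(r)}r\,dr$ if $\rho\le\rho_o$, and $L_2^-(\rho;u_o)=\frac{\rho}{\rho_o}q_o+\sqrt{\frac\rho{\rho_o}(\rho-\rho_o)(p(\rho)-p(\rho_o))}$ if $\rho\ge\rho_o$. For $\bar u\in A_0$, the densities $\check\varphi_l(\bar u),\hat\varphi_l(\bar u),\check\varphi_r(\bar u),\hat\varphi_r(\bar u)$ are the $\rho$-components of the intersections of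 the curves $\rho\mapsto(\rho,L_1(\rho;\bar u))$ (index $l$) and $\rho\mapsto(\rho,L_2^-(\rho;\bar u))$ (index $r$) with the boundary of $A_0$; they are uniquely determined by $$\lambda_2\left(\check\varphi_r,L_2^-(\check\varphi_r;\bar u)\right)=0,\quad\lambda_2\left(\check\varphi_l,L_1(\check\varphi_l;\bar u)\right)=0,\quad\lambda_1\left(\hat\varphi_r,L_2^-(\hat\varphi_r;\bar u)\right)=0,\quad\lambda_1\left(\hat\varphi_l,L_1(\hat\varphi_l;\bar u)\right)=0,$$ all evaluated at $\bar u$. Riemann problem: $\partial_t\rho+\partial_xq=0$, $\partial_tq+\partial_x(q^2/\rho+p(\rho))=0$, with $u(0,x)=\bar u_l$ for $x<0$ and $u(0,x)=\bar u_r$ for $x>0$. Given a junction function $\Phi$, a weak $\Phi$-solution is a map $u\in C^0(\mathbb{R}^+;L^1_{loc}(\mathbb{R};]0,+\infty[\times\mathbb{R}))$, with $u(t)$ of bounded variation for a.e. $t\in\mathbb{R}^+$, such that: (1) $\int_{\mathbb{R}^+}\int_{\mathbb{R}}\left((\rho,q)\,\partial_t\phi+(q,P(\rho,q))\,\partial_x\phi\right)dx\,dt=0$ for all $\phi\in C^1_c(]0,+\infty[\times\mathbb{R};\mathbb{R})$ whose support does not intersect $x=0$; (2) $u(0,x)$ coincides with the Riemann initial datum for a.e. $x\in\mathbb{R}$; (3) for a.e. $t\in\mathbb{R}^+$, $\Phi(a_l,u(t,0-);a_r,u(t,0+))=0$. Solutions to Riemann problems are understood to be made of standard Lax waves: on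 $x<0$, $u$ is a (possibly trivial) Lax wave of the first family joining $\bar u_l$ to the trace $u(t,0-)$, so $q(t,0-)=L_1(\rho(t,0-);\bar u_l)$; on $x>0$, $u$ is a (possibly trivial) Lax wave of the second family joining the trace $u(t,0+)$ to $\bar u_r$, so $q(t,0+)=L_2^-(\rho(t,0+);\bar u_r)$. A (P)-solution is a weak $\Phi$-solution for the junction condition $a_lq_l=a_rq_r$ and $P(\rho_l,q_l)=P(\rho_r,q_r)$ on the traces $(\rho_l,q_l)=u(t,0-)$, $(\rho_r,q_r)=u(t,0+)$.
   Formalization: ''Attaining values in A_0'' is taken as values in the closure of A_0 in ]0,+∞[×R, since equality in the condition gives sonic states outside A_0; the context's claim that the four sonic densities are uniquely determined for every state of A_0 is a hypothesis (it fails for p=ρ^γ, γ>3). *)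

(* Defs.v *)
From HB Require Import structures.
From mathcomp Require Import all_boot all_order all_algebra.
From mathcomp Require Import all_classical all_reals all_analysis.
Set Implicit Arguments.
Unset Strict Implicit.
Unset Printing Implicit Defensive.
Import Order.TTheory GRing.Theory Num.Theory.
Import numFieldNormedType.Exports.
Local Open Scope classical_set_scope.
Local Open Scope ring_scope.

(* States are pairs u = (rho, q) : R * R. *)

Section Pressure.
Variable R : realType.

(* f' is the derivative of f on [0, +oo[, one-sided at 0. *)
Definition is_derivative_Rplus (f f' : R -> R) : Prop :=
  forall x : R, 0 <= x ->
    (fun h : R => h^-1 * (f (x + h) - f x)) @ within [set h | 0 <= x + h] 0^'
      --> f' x.

Definition C2_Rplus (f : R -> R) : Prop :=
  exists f1 f2 : R -> R,
    [/\ is_derivative_Rplus f f1, is_derivative_Rplus f1 f2 &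
        {within [set x | 0 <= x], continuous f2}].

Definition pressure (p : R -> R) : Prop :=
  [/\ C2_Rplus p,
      forall rho : R, 0 <= rho -> 0 <= p rho,
      forall rho : R, 0 < rho -> 0 < derive1 p rho &
      forall rho : R, 0 < rho -> 0 <= derive1n 2 p rho].

End Pressure.

Section Euler.
Variables (R : realType) (p : R -> R).

Local Notation mu := (@lebesgue_measure R).
Local Notation state := (R * R)%type.

Definition sound (rho : R) : R := Num.sqrt (derive1 p rho).

Definition flow (u : state) : R := u.2 ^+ 2 / u.1 + p u.1.

Definition lambda1 (u : state) : R := u.2 / u.1 - sound u.1.
Definition lambda2 (u : state) : R := u.2 / u.1 + sound u.1.

Definition A0 : set state :=
  [set u | [/\ 0 < u.1, lambda1 u < 0 & 0 < lambda2 u]].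

(* The closure of A0 in ]0, +oo[ * R. *)
Definition A0_closed : set state :=
  [set u | [/\ 0 < u.1, lambda1 u <= 0 & 0 <= lambda2 u]].

(* Integral of f from a to b, negative when b < a. *)
Definition oriented_integral (a b : R) (f : R -> R) : R :=
  if a <= b then \int[mu]_(r in `[a, b]) f r
  else - \int[mu]_(r in `[b, a]) f r.

Definition L1 (rho : R) (uo : state) : R :=
  let: (rhoo, qo) := uo in
  if rho <= rhoo then
    rho / rhoo * qo
      - rho * oriented_integral rhoo rho (fun r => sound r / r)
  else
    rho / rhoo * qo
      - Num.sqrt (rho / rhoo * (rho - rhoo) * (p rho - p rhoo)).

Definition L2rev (rho : R) (uo : state) : R :=
  let: (rhoo, qo) := uo in
  if rho <= rhoo then
    rho / rhoo * qo
      + rho * oriented_integral rhoo rho (fun r => sound r / r)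
  else
    rho / rhoo * qo
      + Num.sqrt (rho / rhoo * (rho - rhoo) * (p rho - p rhoo)).

(* The four sonic densities, as functions of the subsonic state.  That the
   equations determine them is an assumption on p that does not follow from
   [pressure p]: it holds for p(rho) = rho^gamma with 1 <= gamma <= 3, but for
   gamma > 3 and some subsonic states checkr does not exist. *)
Definition sonic_densities (hatl checkl hatr checkr : state -> R) : Prop :=
  forall u, A0 u ->
    [/\ unique (fun rho => 0 < rho /\ lambda2 (rho, L2rev rho u) = 0)
               (checkr u),
        unique (fun rho => 0 < rho /\ lambda2 (rho, L1 rho u) = 0) (checkl u),
        unique (fun rho => 0 < rho /\ lambda1 (rho, L2rev rho u) = 0)
               (hatr u) &
        unique (fun rho => 0 < rho /\ lambda1 (rho, L1 rho u) = 0) (hatl u)].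

(* g inverts rho |-> L2rev rho ur on the subsonic part of the curve, sonic end
   points included.  Values of g elsewhere are left free. *)
Definition inverse_L2rev (ur : state) (g : R -> R) : Prop :=
  forall rho, A0_closed (rho, L2rev rho ur) -> g (L2rev rho ur) = rho.

(* Lax waves as functions of xi = x / t. *)

(* First family, from the left state ul to the right state um.  In the
   rarefaction, the two outer clauses and the fan agree at the fan edges. *)
Definition lax_wave1 (ul um : state) (w : R -> state) : Prop :=
  [/\ 0 < um.1, um.2 = L1 um.1 ul &
    if ul.1 < um.1 then
      let s := (um.2 - ul.2) / (um.1 - ul.1) in
      forall xi, w xi = if xi < s then ul else um
    else
      forall xi,
        [/\ xi <= lambda1 ul -> w xi = ul,
            lambda1 um <= xi -> w xi = um &
            lambda1 ul <= xi <= lambda1 um ->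
              [/\ um.1 <= (w xi).1 <= ul.1, (w xi).2 = L1 (w xi).1 ul &
                  lambda1 (w xi) = xi]]].

(* Second family, from the left state um to the right state ur. *)
Definition lax_wave2 (um ur : state) (w : R -> state) : Prop :=
  [/\ 0 < um.1, um.2 = L2rev um.1 ur &
    if ur.1 < um.1 then
      let s := (ur.2 - um.2) / (ur.1 - um.1) in
      forall xi, w xi = if xi < s then um else ur
    else
      forall xi,
        [/\ xi <= lambda2 um -> w xi = um,
            lambda2 ur <= xi -> w xi = ur &
            lambda2 um <= xi <= lambda2 ur ->
              [/\ um.1 <= (w xi).1 <= ur.1, (w xi).2 = L2rev (w xi).1 ur &
                  lambda2 (w xi) = xi]]].

(* An element of L^1_loc(R; ]0, +oo[ * R). *)
Definition L1loc_state (f : R -> state) : Prop :=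
  [/\ locally_integrable setT (fun x => (f x).1),
      locally_integrable setT (fun x => (f x).2) &
      {ae mu, forall x, 0 < (f x).1}].

(* u : t, x |-> u t x is used for 0 <= t only. *)
Definition C0_L1loc (u : R -> R -> state) : Prop :=
  (forall t : R, 0 <= t -> L1loc_state (u t)) /\
  (forall t0 a b : R, 0 <= t0 ->
    (fun t => \int[mu]_(x in `[a, b])
        (`|(u t x).1 - (u t0 x).1| + `|(u t x).2 - (u t0 x).2|)%:E)%E
      @ within [set t | 0 <= t] (nbhs t0) --> 0%E).

Definition BV_line (f : R -> R) : Prop :=
  exists M : R, forall a b : R, a <= b -> (total_variation a b f <= M%:E)%E.

Local Notation dt phi := ('D_((1 : R), (0 : R)) phi).
Local Notation dx phi := ('D_((0 : R), (1 : R)) phi).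

(* phi in C^1_c(]0, +oo[ * R; R), extended by 0, with support disjoint from
   the line x = 0. *)
Definition test_function (phi : R * R -> R) : Prop :=
  [/\ forall z, derivable phi z ((1 : R), (0 : R)) /\
                derivable phi z ((0 : R), (1 : R)),
      continuous (dt phi), continuous (dx phi),
      compact (closure [set z | phi z != 0]) &
      closure [set z | phi z != 0] `<=` [set z | 0 < z.1 /\ z.2 != 0]].

(* The integrals are extended-real valued with +oo - oo = -oo, so that the
   outer one can only vanish if it converges absolutely and the inner ones
   converge absolutely for almost every t. *)
Definition weak_equations (u : R -> R -> state) : Prop :=
  forall phi, test_function phi ->
    (\int[mu]_(t in [set t | 0 <= t]%R) \int[mu]_x
       ((u t x).1 * dt phi (t, x) + (u t x).2 * dx phi (t, x))%:E = 0)%E /\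
    (\int[mu]_(t in [set t | 0 <= t]%R) \int[mu]_x
       ((u t x).2 * dt phi (t, x) + flow (u t x) * dx phi (t, x))%:E = 0)%E.

(* The functions u t are representatives of classes in L^1_loc; for almost
   every t the representative is itself of bounded variation, so that its
   one-sided limits at 0 are the traces. *)
Definition weak_Phi_solution (Phi : R -> state -> R -> state -> R * R)
    (al ar : R) (u0 : R -> state) (u : R -> R -> state) : Prop :=
  [/\ C0_L1loc u,
      {ae mu, forall t, 0 <= t ->
        BV_line (fun x => (u t x).1) /\ BV_line (fun x => (u t x).2)},
      weak_equations u,
      {ae mu, forall x, u 0 x = u0 x} &
      {ae mu, forall t, 0 <= t -> exists um up : state,
        [/\ u t @ (0 : R)^'- --> um, u t @ (0 : R)^'+ --> up &
            Phi al um ar up = (0, 0)]}].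

Definition riemann_datum (ul ur : state) (x : R) : state :=
  if x < 0 then ul else ur.

(* Since um and up are the traces at x = 0, the waves are contained in x < 0
   and in x > 0, respectively. *)
Definition made_of_lax_waves (ul ur : state) (u : R -> R -> state) : Prop :=
  exists (um up : state) (wl wr : R -> state),
    [/\ lax_wave1 ul um wl, lax_wave2 up ur wr,
        {ae mu, forall t, 0 <= t ->
          u t @ (0 : R)^'- --> um /\ u t @ (0 : R)^'+ --> up} &
        forall t : R, 0 < t ->
          {ae mu, forall x, (x < 0 -> u t x = wl (x / t)) /\
                            (0 < x -> u t x = wr (x / t))}].

Definition Phi_P (al : R) (um : state) (ar : R) (up : state) : R * R :=
  (al * um.2 - ar * up.2, flow um - flow up).

(* The sonic states are allowed: with equality in one of the two inequalities
   of the theorem, a trace at the junction is sonic. *)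
Definition subsonic_P_solution (al ar : R) (ul ur : state)
    (u : R -> R -> state) : Prop :=
  [/\ weak_Phi_solution Phi_P al ar (riemann_datum ul ur) u,
      made_of_lax_waves ul ur u &
      forall t : R, 0 <= t -> {ae mu, forall x, A0_closed (u t x)}].

(* Equality in C^0([0, +oo[; L^1_loc). *)
Definition same_solution (u v : R -> R -> state) : Prop :=
  forall t : R, 0 <= t -> {ae mu, forall x, u t x = v t x}.

End Euler.

(* Main.v *)
(* Along the forward 1-curve through a subsonic state u_o, lambda1 decreases
   strictly.  On its subsonic part q therefore decreases and the flow P increases
   with rho: dq = lambda1 drho and dP = lambda1^2 drho on rarefactions, and
   q - q_o = s (rho - rho_o), P - P_o = s^2 (rho - rho_o) with a negative,
   decreasing shock speed s on shocks.  The reversed 2-curve is the mirror image.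
   Hence the jump of P at the junction, with the right state determined by
   a_l q_l = a_r q_r, is strictly increasing in the left density on [l', l''], and
   the two inequalities say that it changes sign there.

   A self-similar function W (x / t) is a weak solution as soon as
   G = f (W) - xi W is continuous across its shocks and satisfies G' = - W
   elsewhere: for a fixed time t, integrating (G phi)' over a sector shows that the
   space integral of W phi_t + f phi_x is the time derivative of the integral of
   W phi, up to boundary terms that telescope. *)

Require Import Defs.
From mathcomp Require Import all_boot all_order all_algebra.
From mathcomp Require Import all_classical all_reals all_analysis.
From mathcomp Require Import measurable_realfun lebesgue_integral_under ring lra.
Import Order.TTheory GRing.Theory Num.Theory.
Import numFieldNormedType.Exports.
Local Open Scope classical_set_scope.
Local Open Scope ring_scope.
Set Implicit Arguments.
Unset Strict Implicit.
Unset Printing Implicit Defensive.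

(** Two solutions with the same data always agree, so the inequalities decide existence; two
    balanced pairs coincide because raising the left density moves the two flows in opposite
    directions. The delicate point on the curves is their second sonic end. Along the forward
    1-curve [lambda1] decreases, but [lambda2] is a decreasing velocity plus a nondecreasing sound
    speed and carries no evident monotonicity. The sonic densities give a single zero of [lambda2],
    not a change of sign. Galilean invariance closes this gap: subtracting a constant from the
    velocity of the subsonic datum turns a small positive level of [lambda2] into the level 0 of
    another subsonic datum, so these levels are attained only once as well, and a tangential zero is
    impossible. On the PDE side, the fluxes on the two sides of the junction differ when [al] and
    [ar] do; this does no harm because test functions vanish on [x = 0]. In a rarefaction fan the
    relation [G' = - W] comes from Cauchy's mean value theorem along the curve and the continuity of
    the density in [xi]. *)

Section RealFunctions.
Variable R : realType.
Implicit Types (f : R -> R) (x y l : R).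

Lemma is_derive1P f x l :
  (fun h : R => h^-1 * (f (x + h) - f x)) @ 0^' --> l <-> is_derive x 1 f l.
Proof.
have E : (fun h : R => h^-1 *: ((f \o shift x) (h *: (1 : R)) - f x))
    = (fun h : R => h^-1 * (f (x + h) - f x)).
  apply/funext => h /=.
  by rewrite /GRing.scale /= mulr1 [h + x]addrC.
split=> [fl|[dfx <-]].
  split; last by rewrite /derive E; apply/cvg_lim.
  by rewrite /derivable E; apply/cvg_ex; exists l.
by move: dfx; rewrite /derivable E => /cvg_ex[m mP]; rewrite /derive E
  (cvg_lim _ mP).
Qed.

Lemma MVT_pos (f df : R -> R) (a b : R) : 0 < a -> a < b ->
  (forall x, 0 < x -> is_derive x 1 f (df x)) ->
  exists2 c, a < c < b & f b - f a = df c * (b - a).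
Proof.
move=> a0 ab fdf.
have [|||c cab E] := @MVT _ f df a b.
- by [].
- move=> x; rewrite in_itv/= => /andP[ax _]; exact: fdf (lt_trans a0 ax).
- apply: derivable_within_continuous => x; rewrite in_itv/= => /andP[ax _].
  by have [] := fdf x (lt_le_trans a0 ax).
- by exists c => //; move: cab; rewrite in_itv.
Qed.

Lemma gt0_nbhs x : 0 < x -> \forall y \near x, 0 < y.
Proof. exact: lt_nbhsr. Qed.

Lemma is_derive_cts f x l : is_derive x 1 f l -> {for x, continuous f}.
Proof. by move=> [d _]; exact/differentiable_continuous/derivable1_diffP. Qed.

End RealFunctions.

(** * Pressure and sound speed: regularity, monotonicity, convexity *)

Section PressureLaw.
Variable R : realType.
Variable p : R -> R.
Hypothesis pp : pressure p.
Local Notation p' := (derive1 p).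

Lemma is_derivative_Rplus_derive (f f' : R -> R) (x : R) :
  is_derivative_Rplus f f' -> 0 < x -> is_derive x 1 f (f' x).
Proof.
move=> ff' x0; apply/is_derive1P.
have {}ff' := ff' x (ltW x0).
move=> A /ff' H.
have {}H : \forall h \near 0^', 0 <= x + h -> A (h^-1 * (f (x + h) - f x)).
  exact: H.
suff: \forall h \near 0^', A (h^-1 * (f (x + h) - f x)) by [].
near=> h.
have : 0 <= x + h -> A (h^-1 * (f (x + h) - f x)) by near: h.
apply; have : `|h| < x by near: h; exact: dnbhs0_lt.
by rewrite ltr_norml => /andP[xh _]; rewrite -lerBlDl sub0r ltW.
Unshelve. all: end_near. Qed.

Lemma pressure_derive (x : R) : 0 < x -> is_derive x 1 p (p' x).
Proof.
move=> x0; have [[f1 [f2 [d1 _ _]]] _ _ _] := pp.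
have H := is_derivative_Rplus_derive d1 x0.
by rewrite derive1E (@derive_val _ _ _ _ _ _ _ H).
Qed.

Lemma pressure_derive2 (x : R) : 0 < x -> is_derive x 1 p' ((derive1 p') x).
Proof.
move=> x0; have [[f1 [f2 [d1 d2 _]]] _ _ _] := pp.
have H := is_derivative_Rplus_derive d2 x0.
have E : \forall y \near x, f1 y = p' y.
  near=> y; have y0 : 0 < y by near: y; exact: gt0_nbhs.
  by rewrite derive1E (@derive_val _ _ _ _ _ _ _ (is_derivative_Rplus_derive d1 y0)).
have H' : is_derive x 1 p' (f2 x).
  by exact: near_eq_is_derive H.
by rewrite derive1E (@derive_val _ _ _ _ _ _ _ H').
Unshelve. all: end_near. Qed.

Lemma dpressure_cts (x : R) : 0 < x -> {for x, continuous p'}.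
Proof. by move/pressure_derive2/is_derive_cts. Qed.

Lemma pressure_cts (x : R) : 0 < x -> {for x, continuous p}.
Proof. by move/pressure_derive/is_derive_cts. Qed.

Lemma dpressure_gt0 (x : R) : 0 < x -> 0 < p' x.
Proof. by have [_ _ H _] := pp; exact: H. Qed.

Lemma dpressure_le (x y : R) : 0 < x -> x <= y -> p' x <= p' y.
Proof.
move=> x0; rewrite le_eqVlt => /predU1P[->//|xy].
have [c /andP[xc _] E] := MVT_pos x0 xy pressure_derive2.
have [_ _ _ H] := pp.
rewrite -subr_ge0 E mulr_ge0 ?subr_ge0 ?(ltW xy)//.
exact: (H c (lt_trans x0 xc)).
Qed.

Local Notation c := (sound p).

Lemma sound_gt0 (x : R) : 0 < x -> 0 < c x.
Proof. by move=> x0; rewrite sqrtr_gt0 dpressure_gt0. Qed.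

Lemma sound_sqr (x : R) : 0 < x -> c x ^+ 2 = p' x.
Proof. by move=> x0; rewrite sqr_sqrtr// ltW// dpressure_gt0. Qed.

Lemma sound_le (x y : R) : 0 < x -> x <= y -> c x <= c y.
Proof. by move=> x0 xy; rewrite ler_wsqrtr// dpressure_le. Qed.

Lemma sound_cts (x : R) : 0 < x -> {for x, continuous c}.
Proof.
move=> x0; apply: (@continuous_comp _ _ _ p' (@Num.sqrt R)).
  exact: dpressure_cts.
exact: sqrt_continuous.
Qed.

Definition slope (a r : R) : R := (p r - p a) / (r - a).

Lemma slopeE (a r : R) : a != r -> p r - p a = slope a r * (r - a).
Proof. by move=> ar; rewrite divfK// subr_eq0 eq_sym. Qed.

Lemma slope_ge (a r : R) : 0 < a -> a < r -> c a ^+ 2 <= slope a r.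
Proof.
move=> a0 ar; have [z /andP[az zr] E] := MVT_pos a0 ar pressure_derive.
rewrite sound_sqr// /slope E mulfK ?subr_eq0 ?gt_eqF//.
by rewrite dpressure_le// ltW.
Qed.

(** Convexity for chords: the chord over [[a, r]] has slope [p' z1] and the one over [[r, s]] has
    slope [p' z2] with [z1 < r < z2], so extending the chord to [s] averages in a slope at least as
    large. *)
Lemma slope_le (a r s : R) : 0 < a -> a < r -> r <= s -> slope a r <= slope a s.
Proof.
move=> a0 ar; rewrite le_eqVlt => /predU1P[->//|rs].
have r0 := lt_trans a0 ar.
have [z1 /andP[az1 z1r] E1] := MVT_pos a0 ar pressure_derive.
have [z2 /andP[rz2 z2s] E2] := MVT_pos r0 rs pressure_derive.
have sa : 0 < s - a by rewrite subr_gt0 (lt_trans ar).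
have H : p' z1 <= p' z2.
  by rewrite dpressure_le ?(lt_trans a0)// (le_trans (ltW z1r))// ltW.
rewrite /slope E1 mulfK ?subr_eq0 ?gt_eqF//.
have -> : p s - p a = (p s - p r) + (p r - p a) by ring.
rewrite ler_pdivlMr// E2 E1.
have -> : s - a = (s - r) + (r - a) by ring.
by rewrite mulrDr lerD2r ler_pM2r// subr_gt0.
Qed.

End PressureLaw.

Arguments L1 : simpl never.
Arguments L2rev : simpl never.

Section ContinuousOnIntervals.
Variable R : realType.
Local Notation mu := (@lebesgue_measure R).
Implicit Types f : R -> R.

Lemma within_itvcc f (a b : R) :
  (forall x, a <= x <= b -> {for x, continuous f}) ->
  {within `[a, b], continuous f}.
Proof.
move=> fab; apply: continuous_in_subspaceT => x.
by rewrite inE/= in_itv/=; exact: fab.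
Qed.

Lemma integrable_itvcc f (a b : R) : {within `[a, b], continuous f} ->
  mu.-integrable `[a, b] (EFin \o f).
Proof.
by move=> cf; apply: continuous_compact_integrable => //; exact: segment_compact.
Qed.

End ContinuousOnIntervals.

Lemma near_cts (R : realType) (f g : R -> R) (x : R) :
  (\forall y \near x, g y = f y) -> {for x, continuous f} ->
  {for x, continuous g}.
Proof.
move=> fg cf; rewrite /prop_for/continuous_at (nbhs_singleton fg).
apply: cvg_trans cf; apply: near_eq_cvg.
by near=> y; apply/esym; near: y.
Unshelve. all: end_near.
Qed.

(** The Rankine-Hugoniot speed of the 1-shock from [(ro, qo)] to density [r]; [L1_shockE] and
    [flow_shockE] are the two jump relations. *)
Definition shock_speed (R : realType) (p : R -> R) (ro qo r : R) : R :=
  qo / ro - Num.sqrt (r / ro * slope p ro r).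

(** * The forward 1-Lax curve *)

Section LaxCurve.
Variable R : realType.
Variable p : R -> R.
Hypothesis pp : pressure p.
Local Notation mu := (@lebesgue_measure R).
Local Notation c := (sound p).
Variables ro qo : R.
Hypothesis ro0 : 0 < ro.

Let h (r : R) := c r / r.
Local Notation L r := (L1 p r (ro, qo)).

Let h_cts (x : R) : 0 < x -> {for x, continuous h}.
Proof.
move=> x0; apply: cvgM; first exact: (sound_cts pp).
by apply: cvgV; [rewrite gt_eqF|exact: cvg_id].
Qed.

Let h_int (a b : R) : 0 < a -> mu.-integrable `[a, b] (EFin \o h).
Proof.
move=> a0; apply: integrable_itvcc; apply: within_itvcc => x /andP[ax _].
by apply: h_cts; exact: lt_le_trans ax.
Qed.

(** [K] is the integral in the formula of the curve, with a variable lower end. [F] moves the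
    variable to the upper end, where the fundamental theorem of calculus applies; its base point [a]
    is positive because [c(r)/r] may fail to be integrable at 0. *)
Let K (x : R) := \int[mu]_(r in `[x, ro]) h r.
Let F (a x : R) := \int[mu]_(r in `[a, x]) h r.

Let KF (a x : R) : 0 < a -> a < x -> x <= ro -> K x = F a ro - F a x.
Proof.
move=> a0 ax xro; rewrite /F Rintegral_itvB ?bnd_simp ?(ltW ax)//; last exact: h_int.
rewrite Rintegral_itv_obnd_cbnd//.
apply: (integrableS _ _ _ (h_int ro a0)) => //.
by apply: subset_itv => //; rewrite bnd_simp ltW.
Qed.

Let F_derive (a x : R) : 0 < a -> a < x -> is_derive x 1 (F a) (h x).
Proof.
move=> a0 ax; have x1 : x < x + 1 by rewrite ltrDl.
have [d E] := continuous_FTC1_closed x1 (h_int (x + 1) a0) ax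
  (h_cts (lt_trans a0 ax)).
by split; [exact: d|rewrite -derive1E; exact: E].
Qed.

Let L1_rarefaction (r : R) : r <= ro -> L r = r * (qo / ro + K r).
Proof.
move=> rro; rewrite /L1 rro /oriented_integral.
have [ror|_] := boolP (ro <= r).
  have -> : r = ro by apply/eqP; rewrite eq_le rro.
  by rewrite /K set_itv1 !Rintegral_set1 mulr0 subr0 addr0; ring.
by rewrite -/(K r); ring.
Qed.

(** The velocity of the gas in the state [(ro, qo)] relative to the shock. *)
Let zeta (r : R) := Num.sqrt (r / ro * slope p ro r).

Let L1_shock (r : R) : ro < r -> L r = r * (qo / ro) - (r - ro) * zeta r.
Proof.
move=> ror; rewrite /L1 leNgt ror /= (slopeE p (a := ro)) ?lt_eqF// .
have -> : r / ro * (r - ro) * (slope p ro r * (r - ro)) =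
  (r - ro) ^+ 2 * (r / ro * slope p ro r) by ring.
rewrite sqrtrM ?sqr_ge0// sqrtr_sqr gtr0_norm ?subr_gt0//.
by rewrite -/(zeta r); ring.
Qed.

Lemma L1_start : L ro = qo.
Proof.
by rewrite L1_rarefaction// /K set_itv1 Rintegral_set1 addr0 mulrC divfK ?gt_eqF.
Qed.

Let slope_gt0 (r : R) : ro < r -> 0 < slope p ro r.
Proof.
move=> ror; apply: lt_le_trans (slope_ge pp ro0 ror).
by rewrite exprn_gt0// sound_gt0.
Qed.

Let zeta_gt (r : R) : ro < r -> c ro < zeta r.
Proof.
move=> ror; have c0 := sound_gt0 pp ro0; have S := slope_ge pp ro0 ror.
have r0 := lt_trans ro0 ror; have Sr := slope_gt0 ror.
rewrite -[ltLHS]ger0_norm ?(ltW c0)// -sqrtr_sqr ltr_sqrt.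
  by apply: (le_lt_trans S); rewrite ltr_pMl// ltr_pdivlMr// mul1r.
exact: (mulr_gt0 (divr_gt0 r0 ro0) Sr).
Qed.

Let zeta_lt (r s : R) : ro < r -> r < s -> zeta r < zeta s.
Proof.
move=> ror rs; have S' := slope_le pp ro0 ror (ltW rs).
have r0 := lt_trans ro0 ror; have Sr := slope_gt0 ror.
have s0 := lt_trans r0 rs; have Ss := lt_le_trans Sr S'.
rewrite ltr_sqrt; last exact: (mulr_gt0 (divr_gt0 s0 ro0) Ss).
apply: (@lt_le_trans _ _ (s / ro * slope p ro r)).
  by rewrite ltr_pM2r// ltr_pM2r// invr_gt0.
by rewrite ler_pM2l// divr_gt0.
Qed.

Let zeta_sqr (r : R) : ro < r -> zeta r ^+ 2 = r / ro * slope p ro r.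
Proof.
move=> ror; rewrite sqr_sqrtr//.
exact: ltW (mulr_gt0 (divr_gt0 (lt_trans ro0 ror) ro0) (slope_gt0 ror)).
Qed.

Local Notation s r := (shock_speed p ro qo r).

Lemma L1_shockE (r : R) : ro < r -> L r = qo + s r * (r - ro).
Proof.
move=> ror; rewrite L1_shock// /shock_speed -/(zeta r).
by field; rewrite gt_eqF.
Qed.

Lemma flow_shockE (r : R) : ro < r ->
  flow p (r, L r) = flow p (ro, qo) + s r ^+ 2 * (r - ro).
Proof.
move=> ror; have r0 := lt_trans ro0 ror.
rewrite /flow/= L1_shockE//.
(* Solving the definition of the speed for [p r] removes the square root: [(qo / ro - s)^2 = zeta^2
   = r / ro * slope]. What remains is an identity of rational functions. *)
have -> : p r = p ro + (r - ro) * (ro / r * (qo / ro - s r) ^+ 2).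
  rewrite /shock_speed -/(zeta r) opprB [qo / ro + _]addrC subrK.
  rewrite zeta_sqr//.
  have -> : (r - ro) * (ro / r * (r / ro * slope p ro r)) = slope p ro r * (r - ro).
    by field; rewrite !gt_eqF.
  by rewrite -slopeE ?lt_eqF// addrC subrK.
by field; rewrite !gt_eqF.
Qed.

Lemma shock_speed_lt (r t : R) : ro < r -> r < t -> s t < s r.
Proof. by move=> ror rt; rewrite ltrD2l ltrN2; exact: zeta_lt. Qed.

(** Half of Lax's entropy condition: the characteristics of the left state run into the shock. For a
    subsonic left state it makes the speed negative. *)
Lemma shock_speed_lt_lambda1 (r : R) : ro < r -> s r < lambda1 p (ro, qo).
Proof. by move=> ror; rewrite ltrD2l ltrN2; exact: zeta_gt. Qed.

Lemma L1_cts (x : R) : 0 < x -> {for x, continuous (fun r => L r)}.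
Proof.
move=> x0; pose a := Order.min x ro / 2.
have m0 : 0 < Order.min x ro by rewrite lt_min x0.
have a0 : 0 < a by rewrite divr_gt0.
have am : a < Order.min x ro by rewrite ltr_pdivrMr// ltr_pMr// ltr1n.
have [ax aro] : a < x /\ a < ro by move: am; rewrite lt_min => /andP[].
(* [G] evaluates each branch at [r] clamped to the side of [ro] where that branch is valid. On the
   other side its contribution is 0, so the curve is a single continuous expression and no gluing at
   [ro] is required. *)
pose G (r : R) := r * (qo / ro + (F a ro - F a (Order.min r ro))) -
  Num.sqrt (Order.max r ro / ro * (Order.max r ro - ro) *
            (p (Order.max r ro) - p ro)).
apply: (@near_cts _ G).
  near=> r; have ar : a < r by near: r; exact: lt_nbhsr.
  rewrite /G; have [rro|ror] := leP r ro.
    rewrite L1_rarefaction// (KF a0 ar rro).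
    by rewrite subrr mulr0 mul0r sqrtr0 subr0.
  by rewrite subrr addr0 /L1 leNgt ror /= [r / ro * qo]mulrAC mulrA.
have cmin : {for x, continuous (fun r => Order.min r ro)}.
  by apply: continuous_min; [exact: cvg_id|exact: cvg_cst].
have cmax : {for x, continuous (fun r => Order.max r ro)}.
  by apply: continuous_max; [exact: cvg_id|exact: cvg_cst].
apply: cvgB.
  apply: cvgM; first exact: cvg_id.
  apply: cvgD; first exact: cvg_cst.
  apply: cvgB; first exact: cvg_cst.
  apply: (@continuous_comp _ _ _ (fun r => Order.min r ro) (F a)) => //.
  exact: is_derive_cts (F_derive a0 am).
apply: (@continuous_comp _ _ _ (fun r => Order.max r ro / ro *
  (Order.max r ro - ro) * (p (Order.max r ro) - p ro)) (@Num.sqrt R));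
  last exact: sqrt_continuous.
have cp : {for x, continuous (fun r => p (Order.max r ro))}.
  apply: (@continuous_comp _ _ _ (fun r => Order.max r ro) p) => //.
  by apply: (pressure_cts pp); rewrite lt_max x0.
apply: cvgM; last by apply: cvgB; [exact: cp|exact: cvg_cst].
apply: cvgM; last by apply: cvgB; [exact: cmax|exact: cvg_cst].
by apply: cvgM; [exact: cmax|exact: cvg_cst].
Unshelve. all: end_near. Qed.

Lemma L1_derive (x : R) : 0 < x -> x < ro ->
  is_derive x 1 (fun r => L r) (lambda1 p (x, L x)).
Proof.
move=> x0 xro; pose a := x / 2.
have a0 : 0 < a by rewrite divr_gt0.
have ax : a < x by rewrite ltr_pdivrMr// ltr_pMr// ltr1n.
have Fd := F_derive a0 ax.
have H : is_derive x 1 (fun r => r * (qo / ro + (F a ro - F a r)))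
    (lambda1 p (x, L x)).
  apply: is_derive_eq.
  rewrite /lambda1/= L1_rarefaction ?ltW// (KF a0 ax (ltW xro)).
  by rewrite /GRing.scale/= /h; field; rewrite !gt_eqF.
apply: near_eq_is_derive H.
near=> r; have ar : a < r by near: r; exact: lt_nbhsr.
have rro : r < ro by near: r; exact: lt_nbhsl.
by rewrite L1_rarefaction ?ltW// (KF a0 ar (ltW rro)).
Unshelve. all: end_near. Qed.

Lemma flow_L1_derive (x : R) : 0 < x -> x < ro ->
  is_derive x 1 (fun r => flow p (r, L r)) (lambda1 p (x, L x) ^+ 2).
Proof.
move=> x0 xro; have Ld := L1_derive x0 xro; have pd := pressure_derive pp x0.
rewrite /flow/=.
have x0' : x != 0 by rewrite gt_eqF.
have Vd := is_deriveV x0' (is_derive_id x (1 : R)).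
have Qd := is_deriveM (is_deriveM Ld Ld) Vd.
have H := is_deriveD Qd pd.
apply: (@is_derive_eq _ _ _ _ _ _ _ _ H).
rewrite -(sound_sqr pp x0) /lambda1/= /GRing.scale/= !fctE.
by field; rewrite gt_eqF.
Qed.

(** On rarefactions the velocity loses the integral of [c(r)/r]; on shocks it is [qo / ro] minus the
    product of [1 - ro / r] and [zeta r], both of which increase. With the monotone sound speed this
    makes [lambda1] strictly decreasing on the whole curve. *)
Lemma velocity_lt (r t : R) : 0 < r -> r < t -> L t / t < L r / r.
Proof.
move=> r0 rt; have t0 := lt_trans r0 rt.
have vR (x : R) : 0 < x -> x <= ro -> L x / x = qo / ro + K x.
  by move=> x0 xro; rewrite L1_rarefaction// mulrC mulKf// gt_eqF.
have vS (x : R) : ro < x -> L x / x = qo / ro - (1 - ro / x) * zeta x.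
  move=> rox; rewrite L1_shock//; field.
  by rewrite !gt_eqF// (lt_trans ro0).
have K0 : K ro = 0 by rewrite /K set_itv1 Rintegral_set1.
have Klt (x y : R) : 0 < x -> x < y -> y <= ro -> K y < K x.
  move=> x0 xy yro; pose a := x / 2.
  have a0 : 0 < a by rewrite divr_gt0.
  have ax : a < x by rewrite ltr_pdivrMr// ltr_pMr// ltr1n.
  rewrite (KF a0 ax) ?(le_trans (ltW xy))// (KF a0 (lt_trans ax xy))//.
  rewrite ltrD2l ltrN2 -subr_gt0.
  have [||z] := @MVT _ (F a) h x y xy.
  - by move=> z; rewrite in_itv/= => /andP[xz _]; apply: F_derive => //; exact: lt_trans xz.
  - apply: within_itvcc => z /andP[xz _].
    by apply: is_derive_cts (F_derive a0 _); exact: lt_le_trans xz.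
  rewrite in_itv/= => /andP[xz _] ->.
  have z0 := lt_trans x0 xz.
  by rewrite mulr_gt0 ?subr_gt0// divr_gt0// sound_gt0.
have vSlt (x : R) : ro < x -> L x / x < qo / ro.
  move=> rox; rewrite vS// gtrDl oppr_lt0 mulr_gt0//.
    by rewrite subr_gt0 ltr_pdivrMr ?mul1r// (lt_trans ro0).
  by rewrite (lt_trans _ (zeta_gt rox))// sound_gt0.
have [tro|rot] := leP t ro.
  by rewrite !vR ?ltrD2l ?Klt// (le_trans (ltW rt)).
have [rro|ror] := leP r ro.
  apply: (lt_le_trans (vSlt _ rot)); rewrite vR// lerDl -K0.
  by move: rro; rewrite le_eqVlt => /predU1P[->//|rro]; rewrite ltW// Klt.
rewrite !vS// ltrD2l ltrN2.
apply: ltr_pM.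
- by rewrite subr_ge0 ler_pdivrMr ?mul1r ?ltW// (lt_trans ro0).
- by rewrite (le_trans _ (ltW (zeta_gt ror)))// ltW// sound_gt0.
- by rewrite ltrD2l ltrN2 ltr_pM2l// ltf_pV2 ?posrE.
- exact: zeta_lt.
Qed.

Lemma lambda1_L1_lt (r t : R) : 0 < r -> r < t ->
  lambda1 p (t, L t) < lambda1 p (r, L r).
Proof.
move=> r0 rt; apply: ltr_leB; first exact: velocity_lt.
by rewrite (sound_le pp)// ltW.
Qed.

Lemma lambda1_L1_cts (x : R) : 0 < x ->
  {for x, continuous (fun r => lambda1 p (r, L r))}.
Proof.
move=> x0; apply: cvgB; last exact: (sound_cts pp).
apply: cvgM; first exact: L1_cts.
by apply: cvgV; [rewrite gt_eqF|exact: cvg_id].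
Qed.

Lemma lambda2_L1_cts (x : R) : 0 < x ->
  {for x, continuous (fun r => lambda2 p (r, L r))}.
Proof.
move=> x0; apply: cvgD; last exact: (sound_cts pp).
apply: cvgM; first exact: L1_cts.
by apply: cvgV; [rewrite gt_eqF|exact: cvg_id].
Qed.

Lemma flow_L1_cts (x : R) : 0 < x ->
  {for x, continuous (fun r => flow p (r, L r))}.
Proof.
move=> x0; apply: cvgD; last exact: (pressure_cts pp).
apply: cvgM; last by apply: cvgV; [rewrite gt_eqF|exact: cvg_id].
by apply: cvgM; exact: L1_cts.
Qed.

(** Only the sign of [lambda1] matters: nonpositive at [r], it is negative beyond, so [t] may even
    pass the density where [lambda2] vanishes. An interval containing [ro] is cut there into a
    rarefaction and a shock part. *)
Lemma L1_flow_lt (r t : R) : lambda1 p (ro, qo) < 0 ->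
  0 < r -> r < t -> lambda1 p (r, L r) <= 0 ->
  L t < L r /\ flow p (r, L r) < flow p (t, L t).
Proof.
move=> sub r0 rt sr.
have rare (x y : R) : 0 < x -> x < y -> y <= ro -> lambda1 p (x, L x) <= 0 ->
    L y < L x /\ flow p (x, L x) < flow p (y, L y).
  move=> x0 xy yro sx; split.
    have [||z] := @MVT _ (fun r => L r) (fun r => lambda1 p (r, L r)) x y xy.
    - move=> z; rewrite in_itv/= => /andP[xz zy].
      by apply: L1_derive; [exact: lt_trans xz|exact: lt_le_trans yro].
    - by apply: within_itvcc => z /andP[xz _]; apply: L1_cts; exact: lt_le_trans xz.
    rewrite in_itv/= => /andP[xz _] E; rewrite -subr_lt0 E.
    have z0 := lt_le_trans (lambda1_L1_lt x0 xz) sx.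
    by rewrite nmulr_rlt0 ?subr_gt0.
  have [||z] := @MVT _ (fun r => flow p (r, L r))
    (fun r => lambda1 p (r, L r) ^+ 2) x y xy.
  - move=> z; rewrite in_itv/= => /andP[xz zy].
    by apply: flow_L1_derive; [exact: lt_trans xz|exact: lt_le_trans yro].
  - by apply: within_itvcc => z /andP[xz _]; apply: flow_L1_cts; exact: lt_le_trans xz.
  rewrite in_itv/= => /andP[xz _] E; rewrite -subr_gt0 E.
  rewrite mulr_gt0 ?subr_gt0// -sqrrN exprn_gt0// oppr_gt0 (lt_le_trans _ sx)//.
  exact: lambda1_L1_lt.
have shock (x y : R) : ro <= x -> x < y ->
    L y < L x /\ flow p (x, L x) < flow p (y, L y).
  move=> rox xy; have roy : ro < y by exact: le_lt_trans xy.
  have sy : s y < 0 by apply: lt_trans (shock_speed_lt_lambda1 roy) sub.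
  rewrite (flow_shockE roy) (L1_shockE roy).
  move: rox; rewrite le_eqVlt => /predU1P[<-|rox].
    rewrite L1_start gtrDl ltrDl; split.
      by rewrite nmulr_rlt0 ?subr_gt0.
    by rewrite mulr_gt0 ?subr_gt0// -sqrrN exprn_gt0// oppr_gt0.
  have sx : s x < 0 by apply: lt_trans (shock_speed_lt_lambda1 rox) sub.
  have sxy := shock_speed_lt rox xy.
  rewrite (flow_shockE rox) (L1_shockE rox) !ltrD2l.
  have d1 : 0 < x - ro by rewrite subr_gt0.
  have d12 : x - ro < y - ro by rewrite ltrD2r.
  split.
    apply: (@lt_trans _ _ (s y * (x - ro))); first by rewrite ltr_nM2l.
    by rewrite ltr_pM2r.
  have ss : s x ^+ 2 < s y ^+ 2.
    by rewrite -[s x ^+ 2]sqrrN -[s y ^+ 2]sqrrN ltr_pXn2r ?nnegrE ?oppr_ge0 ?ltW// ltrN2.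
  by rewrite ltr_pM// ?sqr_ge0// ltW.
have [tro|rot] := leP t ro; first exact: rare.
have [ror|rro] := leP ro r; first exact: shock.
have [A1 A2] := rare r ro r0 rro (lexx _) sr.
have [B1 B2] := shock ro t (lexx _) rot.
by split; [exact: lt_trans A1|exact: lt_trans B2].
Qed.

End LaxCurve.

Lemma within_comp (R : realType) (A B : set R) (f g : R -> R) :
  (forall x, A x -> B (f x)) -> {within A, continuous f} ->
  {within B, continuous g} -> {within A, continuous (g \o f)}.
Proof.
move=> AB /subspace_continuousP cf /subspace_continuousP cg.
apply/subspace_continuousP => x Ax; apply: cvg_comp (cg _ (AB _ Ax)) => P.
rewrite /within/= => /(cf x Ax) H.
suff: \forall y \near x, A y -> P (f y) by [].
have {}H : \forall y \near x, A y -> B (f y) -> P (f y) by exact: H.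
near=> y => Ay; have : A y -> B (f y) -> P (f y) by near: y.
by apply => //; exact: AB.
Unshelve. all: end_near. Qed.

(** * Level crossings and level sets of functions of one variable *)

Section Crossing.
Variable R : realType.
Implicit Types f : R -> R.

Lemma IVT_pos f (a b v : R) : 0 < a -> a <= b ->
  (forall x, 0 < x -> {for x, continuous f}) ->
  Order.min (f a) (f b) <= v <= Order.max (f a) (f b) ->
  exists2 z, a <= z <= b & f z = v.
Proof.
move=> a0 ab cf fv; have [|z zab fz] := IVT ab _ fv.
  by apply: within_itvcc => x /andP[ax _]; apply: cf; exact: lt_le_trans ax.
by exists z => //; move: zab; rewrite in_itv.
Qed.

(* If all small upward shifts of the level 0 are attained only once, then f
   crosses 0 at its zero: a tangential zero would split in two. *)
Lemma unique_crossing f (h ro z : R) : 0 < h -> h < ro ->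
  (forall x, 0 < x -> {for x, continuous f}) ->
  (forall r, 0 < r -> r <= h -> 0 < f r) -> 0 < f ro ->
  (forall e, 0 <= e -> e < f ro -> forall x y, 0 < x -> 0 < y ->
     f x = e -> f y = e -> x = y) ->
  0 < z -> f z = 0 ->
  [/\ ro < z, forall r, 0 < r -> r < z -> 0 < f r &
      forall r, z < r -> f r < 0].
Proof.
move=> h0 hro cf fh fro uf z0 fz.
have ro0 := lt_trans h0 hro.
have uz x : 0 < x -> f x = 0 -> x = z.
  by move=> x0 fx; apply: (uf 0).
have noz (a b : R) : 0 < a -> a < z -> z < b -> 0 < f a -> 0 < f b -> False.
  (* The level [e] lies below [f a] and [f b], so that it is attained on both sides of [z], and
     below [f ro], so that its uniqueness is known. *)
  move=> a0 az zb fa fb; pose m := Order.min (f ro) (Order.min (f a) (f b)).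
  have m0 : 0 < m by rewrite !lt_min fro fa.
  pose e := m / 2; have e0 : 0 < e by rewrite divr_gt0.
  have em : e < m by rewrite ltr_pdivrMr// ltr_pMr// ltr1n.
  have /andP[ero /andP[ea eb]] : (e < f ro) && ((e < f a) && (e < f b)).
    by rewrite -!lt_min.
  have [|x /andP[ax xz] fx] := @IVT_pos f a z e a0 (ltW az) cf.
    by rewrite fz ge_min (ltW e0) orbT le_max (ltW ea).
  have [|y /andP[zy yb] fy] := @IVT_pos f z b e z0 (ltW zb) cf.
    by rewrite fz ge_min (ltW e0) le_max (ltW eb) orbT.
  have x0 := lt_le_trans a0 ax; have y0 := lt_le_trans z0 zy.
  have xy : x = y by apply: (uf e); rewrite // ltW.
  have xz' : x = z by apply/eqP; rewrite eq_le xz xy.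
  by move: fx e0; rewrite xz' fz => <-; rewrite ltxx.
have hz : h < z.
  by rewrite ltNge; apply/negP => zh; have := fh _ z0 zh; rewrite fz ltxx.
have roz : ro < z.
  have [//|zro] := ltP ro z; exfalso.
  move: zro; rewrite le_eqVlt => /predU1P[E|zro]; first by move: fro; rewrite -E fz ltxx.
  by apply: (noz h ro) => //; exact: fh.
split => // r.
  move=> r0 rz; rewrite ltNge; apply/negP => fr.
  have hr : h < r.
    by rewrite ltNge; apply/negP => rh; have := fh _ r0 rh; rewrite ltNge fr.
  have [|x /andP[hx xr] fx] := @IVT_pos f h r 0 h0 (ltW hr) cf.
    by rewrite ge_min fr orbT le_max ltW// fh.
  have := uz x (lt_le_trans h0 hx) fx => E.
  by move: rz; rewrite -E ltNge xr.
move=> zr; rewrite ltNge; apply/negP; rewrite le_eqVlt => /predU1P[fr|fr].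
  have := uz r (lt_trans z0 zr) (esym fr) => E.
  by move: zr; rewrite E ltxx.
exact: (noz ro r).
Qed.

(** The sublevel set of a decreasing continuous function is a segment ending at [b], so the infimum
    belongs to it. The assumption at [b] keeps the set nonempty, hence the infimum meaningful. *)
Lemma sublevel_inf f (a b y : R) : a <= b -> {within `[a, b], continuous f} ->
  (forall r s, a <= r -> r < s -> s <= b -> f s < f r) -> f b <= y ->
  let m := inf [set r | a <= r <= b /\ f r <= y] in
  a <= m <= b /\ forall r, a <= r <= b -> (f r <= y <-> m <= r).
Proof.
move=> ab cf df fb m.
have [z [/andP[az zb] fz]] : exists z, a <= z <= b /\
    forall r, a <= r <= b -> (f r <= y <-> z <= r).
  have [fa|fa] := leP (f a) y.
    exists a; rewrite lexx ab; split => // r /andP[ar rb]; split => // _.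
    move: ar; rewrite le_eqVlt => /predU1P[<-//|ar].
    by rewrite (le_trans _ fa)// ltW// df.
  have [|z] := @IVT R f a b y ab cf; first by rewrite ge_min fb orbT le_max (ltW fa).
  rewrite in_itv/= => zab fz; exists z; split => // r /andP[ar rb].
  move/andP: zab => [az zb]; rewrite -fz; split => [frz|].
    by rewrite leNgt; apply/negP => rz; move: frz; rewrite leNgt df.
  by rewrite le_eqVlt => /predU1P[->//|zr]; rewrite ltW// df.
suff -> : m = z by rewrite az zb.
rewrite /m (_ : [set r | _] = `[z, b]%classic) ?inf_itv//.
apply/seteqP; split => r /=; rewrite in_itv/=.
  by move=> [/andP[ar rb] fr]; rewrite rb andbT -fz// ar.
move=> /andP[zr rb]; have ar := le_trans az zr.
by rewrite ar rb; split => //; apply/fz => //; rewrite ar.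
Qed.

Lemma suplevel_sup f (a b y : R) : a <= b -> {within `[a, b], continuous f} ->
  (forall r s, a <= r -> r < s -> s <= b -> f s < f r) -> y <= f a ->
  let m := sup [set r | a <= r <= b /\ y <= f r] in
  a <= m <= b /\ forall r, a <= r <= b -> (y <= f r <-> r <= m).
Proof.
move=> ab cf df fa m.
have [z [/andP[az zb] fz]] : exists z, a <= z <= b /\
    forall r, a <= r <= b -> (y <= f r <-> r <= z).
  have [fb|fb] := leP y (f b).
    exists b; rewrite lexx ab; split => // r /andP[ar rb]; split => // _.
    move: rb; rewrite le_eqVlt => /predU1P[->//|rb].
    by rewrite (le_trans fb)// ltW// df.
  have [|z] := @IVT R f a b y ab cf; first by rewrite ge_min (ltW fb) orbT le_max fa.
  rewrite in_itv/= => zab fz; exists z; split => // r /andP[ar rb].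
  move/andP: zab => [az zb]; rewrite -fz; split => [frz|].
    by rewrite leNgt; apply/negP => rz; move: frz; rewrite leNgt df.
  by rewrite le_eqVlt => /predU1P[->//|zr]; rewrite ltW// df.
suff -> : m = z by rewrite az zb.
rewrite /m (_ : [set r | _] = `[a, z]%classic) ?sup_itv//.
apply/seteqP; split => r /=; rewrite in_itv/=.
  by move=> [/andP[ar rb] fr]; rewrite ar/= -fz// ar.
move=> /andP[ar rz]; have rb := le_trans rz zb.
by rewrite ar rb; split => //; apply/fz => //; rewrite ar.
Qed.

End Crossing.

(** * Balance at the junction, for abstract monotone branches *)

Section Junction.
Variable R : realType.
Variables (Q S fl : R -> R) (fr : R -> R -> R) (g : R -> R).
Variables (hl kl hr kr al ar : R).
Hypotheses (al0 : 0 < al) (ar0 : 0 < ar) (hkl : hl <= kl) (hkr : hr <= kr).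
Hypothesis Qc : {within `[hl, kl], continuous Q}.
Hypothesis Sc : {within `[hr, kr], continuous S}.
Hypothesis flc : {within `[hl, kl], continuous fl}.
Hypothesis frc : {within `[hr, kr], continuous (fun r => fr r (S r))}.
Hypothesis Qd : forall r s, hl <= r -> r < s -> s <= kl -> Q s < Q r.
Hypothesis Si : forall r s, hr <= r -> r < s -> s <= kr -> S r < S s.
Hypothesis fli : forall r s, hl <= r -> r < s -> s <= kl -> fl r < fl s.
Hypothesis fri : forall r s, hr <= r -> r < s -> s <= kr ->
  fr r (S r) < fr s (S s).
Hypotheses (Qh : 0 < Q hl) (Qk : Q kl < 0) (Sh : S hr < 0) (Sk : 0 < S kr).
Hypothesis gS : forall r, hr <= r <= kr -> g (S r) = r.

Definition balanced rl rr :=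
  [/\ hl <= rl <= kl, hr <= rr <= kr, al * Q rl = ar * S rr &
      fl rl = fr rr (S rr)].

(** A larger left density means a smaller left momentum, hence a smaller right momentum and a
    smaller right density. The left flow goes up and the right one down, so they cannot balance
    twice. *)
Lemma balanced_uniq rl rr rl' rr' :
  balanced rl rr -> balanced rl' rr' -> rl = rl' /\ rr = rr'.
Proof.
move: rl rr rl' rr'.
have key a b a' b' : balanced a b -> balanced a' b' -> a < a' -> False.
  move=> [/andP[ha ak] /andP[hb bk] E F] [/andP[ha' ak'] /andP[hb' bk'] E' F'] aa'.
  have QQ := Qd ha aa' ak'.
  have SS : S b' < S b by rewrite -(ltr_pM2l ar0) -E -E' ltr_pM2l.
  have bb : b' < b.
    rewrite ltNge; apply/negP; rewrite le_eqVlt => /predU1P[bb|bb].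
      by move: SS; rewrite bb ltxx.
    by have := lt_trans SS (Si hb bb bk'); rewrite ltxx.
  have := fli ha aa' ak'; have := fri hb' bb bk.
  by rewrite F F' => /lt_trans /[apply]; rewrite ltxx.
move=> rl rr rl' rr' B B'.
have E : rl = rl'.
  by have [l|l|//] := ltgtP rl rl'; exfalso; [exact: key B B' l|exact: key B' B l].
split => //; move: B B' => [_ /andP[hb bk] EE _] [_ /andP[hb' bk'] EE' _].
have SS : S rr = S rr'.
  by apply: (mulfI (lt0r_neq0 ar0)); rewrite -EE -EE' E.
have [l|l|//] := ltgtP rr rr'; first by have := Si hb l bk'; rewrite SS ltxx.
by have := Si hb' l bk; rewrite SS ltxx.
Qed.

(** The right momentum imposed by conservation of mass. In [Fj] the flow [fr] takes density and
    momentum separately, because [(g (y r), y r)] is a point of the right branch only when [y r] is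
    in the range of [S]. *)
Let y r := al / ar * Q r.
Let Fj r := fl r - fr (g (y r)) (y r).

Let yE r s : al * Q r <= ar * s <-> y r <= s.
Proof. by rewrite /y mulrAC ler_pdivrMr// [s * _]mulrC. Qed.

Let yE' r s : ar * s <= al * Q r <-> s <= y r.
Proof. by rewrite /y mulrAC ler_pdivlMr// [s * _]mulrC. Qed.

Let S_in (v : R) : S hr <= v <= S kr -> exists2 r, hr <= r <= kr & S r = v.
Proof.
move=> /andP[v1 v2]; have [|r] := @IVT R S hr kr v hkr Sc.
  by rewrite ge_min v1 le_max v2 orbT.
by rewrite in_itv/= => rhk E; exists r.
Qed.

Lemma balancedP :
  let l1 := inf [set r | hl <= r <= kl /\ al * Q r <= ar * S kr] in
  let l2 := sup [set r | hl <= r <= kl /\ ar * S hr <= al * Q r] in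
  (Fj l1 <= 0 /\ 0 <= Fj l2) <-> exists rl rr, balanced rl rr.
Proof.
move=> l1 l2.
have Qc' : {within `[hl, kl], continuous (fun r => al * Q r)}.
  by move=> x; apply: cvgM; [exact: cvg_cst|exact: Qc].
have Qd' r s : hl <= r -> r < s -> s <= kl -> al * Q s < al * Q r.
  by move=> ? ? ?; rewrite ltr_pM2l// Qd.
have [|/andP[hl1 l1k] l1P] :=
  @sublevel_inf _ (fun r => al * Q r) hl kl (ar * S kr) hkl Qc' Qd'.
  by apply: (@le_trans _ _ 0); [rewrite ltW// pmulr_rlt0|rewrite ltW// mulr_gt0].
have [|/andP[hl2 l2k] l2P] :=
  @suplevel_sup _ (fun r => al * Q r) hl kl (ar * S hr) hkl Qc' Qd'.
  by apply: (@le_trans _ _ 0); [rewrite ltW// pmulr_rlt0|rewrite ltW// mulr_gt0].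
rewrite -/l1 in hl1 l1k l1P; rewrite -/l2 in hl2 l2k l2P.
(* The density at which the left momentum vanishes belongs to both sets, because
   [S hr < 0 < S kr]. *)
have l12 : l1 <= l2.
  have [|z] := @IVT R Q hl kl 0 hkl Qc.
    by rewrite ge_min (ltW Qk) orbT le_max (ltW Qh).
  rewrite in_itv/= => zhk Qz; apply: (@le_trans _ _ z).
    by apply/l1P => //; rewrite Qz mulr0 ltW// mulr_gt0.
  by apply/l2P => //; rewrite Qz mulr0 ltW// pmulr_rlt0.
(* Between [l1] and [l2] the imposed momentum stays in the range of [S], so [g] is only evaluated
   where it is known to be the inverse. *)
have yr r : l1 <= r <= l2 -> S hr <= y r <= S kr.
  move=> /andP[lr rl]; have rhk : hl <= r <= kl.
    by rewrite (le_trans hl1)// (le_trans rl).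
  by apply/andP; split; [apply/yE'/l2P|apply/yE/l1P].
have Fi r s : l1 <= r -> r < s -> s <= l2 -> Fj r < Fj s.
  move=> lr rs sl.
  have [a /andP[ha ak] Ea] : exists2 a, hr <= a <= kr & S a = y r.
    by apply/S_in/yr; rewrite lr (le_trans (ltW rs)).
  have [b /andP[hb bk] Eb] : exists2 b, hr <= b <= kr & S b = y s.
    by apply/S_in/yr; rewrite sl (le_trans lr)// ltW.
  rewrite /Fj -Ea -Eb !gS ?ha ?hb//.
  apply: ltrB; first by apply: fli => //; [exact: le_trans lr|exact: le_trans l2k].
  apply: fri => //; rewrite ltNge; apply/negP => ab.
  have yy : y s < y r.
    rewrite /y ltr_pM2l ?divr_gt0//.
    by apply: Qd => //; [exact: le_trans lr|exact: le_trans l2k].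
  move: ab; rewrite le_eqVlt => /predU1P[ab|ab].
    by move: yy; rewrite -Ea -Eb ab ltxx.
  by move: yy; rewrite -Ea -Eb => /lt_trans/(_ (Si ha ab bk)); rewrite ltxx.
have FB r : l1 <= r <= l2 -> Fj r = 0 -> balanced r (g (y r)).
  move=> rl F0; have [a ahk Ea] := S_in (yr r rl).
  move/andP: rl => [lr rl].
  split; first by rewrite (le_trans hl1)// (le_trans rl).
  - by rewrite -Ea gS.
  - by rewrite -Ea gS// Ea /y mulrA [ar * _]mulrC divfK// gt_eqF.
  - by apply/eqP; rewrite -subr_eq0 -F0 /Fj -Ea !gS.
split=> [[F1 F2]|[rl [rr B]]].
  have yc : {within `[l1, l2], continuous Fj}.
    have sub : `[l1, l2] `<=` `[hl, kl].
      by move=> x /=; rewrite !in_itv/= => /andP[lx xl]; rewrite (le_trans hl1)// (le_trans xl).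
    (* Nothing is assumed about the continuity of [g]; it follows from [g] being a left inverse of a
       continuous function on a segment. *)
    have gc : {within `[S hr, S kr], continuous g}.
      apply: segment_can_le_continuous => // r; rewrite in_itv/=; exact: gS.
    have yc : {within `[l1, l2], continuous y}.
      apply: continuous_subspaceW sub _ => x.
      by apply: cvgM; [exact: cvg_cst|exact: Qc].
    have gyc : {within `[l1, l2], continuous (g \o y)}.
      apply: within_comp yc gc => x /=; rewrite !in_itv/=; exact: yr.
    have frgc : {within `[l1, l2], continuous ((fun r => fr r (S r)) \o (g \o y))}.
      apply: within_comp gyc frc => x /=; rewrite !in_itv/= => xl.
      by have [a ahk <-] := S_in (yr x xl); rewrite gS.
    apply: (@subspace_eq_continuous _ _ _
        (fl \- ((fun r => fr r (S r)) \o (g \o y)))).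
      move=> x; rewrite inE/= in_itv/= => xl.
      by rewrite /from_subspace /Fj /=; have [a ahk <-] := S_in (yr x xl); rewrite gS.
    move=> x; apply: cvgB; last exact: frgc.
    exact: (continuous_subspaceW sub flc).
  have [|z] := @IVT R Fj l1 l2 0 l12 yc; first by rewrite ge_min F1 le_max F2 orbT.
  by rewrite in_itv/= => zl Fz; exists z, (g (y z)); exact: FB.
(* The right momentum of a balanced pair is in the range of [S], which places [rl] between [l1] and
   [l2]. There [Fj] vanishes, and its monotonicity gives the signs at the two ends. *)
have [/andP[ha ak] /andP[hb bk] E F] := B.
have rl1 : l1 <= rl.
  apply/l1P; first by rewrite ha.
  rewrite E ler_pM2l//; move: bk; rewrite le_eqVlt => /predU1P[->//|bk].
  exact/ltW/Si.
have rl2 : rl <= l2.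
  apply/l2P; first by rewrite ha.
  rewrite E ler_pM2l//; move: hb; rewrite le_eqVlt => /predU1P[->//|hb].
  exact/ltW/Si.
have F0 : Fj rl = 0.
  have yS : y rl = S rr by rewrite /y mulrAC E [ar * _]mulrC mulfK// gt_eqF.
  by rewrite /Fj yS gS ?hb// F subrr.
split; rewrite -F0.
  by move: rl1; rewrite le_eqVlt => /predU1P[->//|l]; rewrite ltW// Fi.
by move: rl2; rewrite le_eqVlt => /predU1P[->//|l]; rewrite ltW// Fi.
Qed.

End Junction.

(** * The subsonic part of a Lax curve *)

Section SubsonicBranch.
Variable R : realType.
Variable p : R -> R.
Hypothesis pp : pressure p.
Local Notation c := (sound p).

(* The reflection x |-> -x exchanges the two families. *)
Definition mirror (u : R * R) : R * R := (u.1, - u.2).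

Lemma mirrorK : involutive mirror.
Proof. by move=> [r q]; rewrite /mirror/= opprK. Qed.

Lemma L2rev_mirror (r : R) (u : R * R) : L2rev p r u = - L1 p r (mirror u).
Proof.
case: u => ro qo; rewrite /L2rev /L1 /=.
by case: ifP => _; rewrite mulrN opprB opprK addrC.
Qed.

Lemma lambda1_mirror (u : R * R) : lambda1 p (mirror u) = - lambda2 p u.
Proof. by rewrite /lambda1 /lambda2 /= mulNr opprD. Qed.

Lemma lambda2_mirror (u : R * R) : lambda2 p (mirror u) = - lambda1 p u.
Proof. by rewrite /lambda1 /lambda2 /= mulNr opprB addrC. Qed.

Lemma flow_mirror (u : R * R) : flow p (mirror u) = flow p u.
Proof. by rewrite /flow /= sqrrN. Qed.

Lemma A0_closedW (u : R * R) : A0 p u -> A0_closed p u.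
Proof. by move=> [u0 l1 l2]; split; [exact: u0|exact: ltW|exact: ltW]. Qed.

Lemma A0_mirror (u : R * R) : A0 p (mirror u) <-> A0 p u.
Proof.
suff H v : A0 p v -> A0 p (mirror v) by split=> [/H|/H//]; rewrite mirrorK.
move=> [v0 v1 v2]; split; rewrite ?lambda1_mirror ?lambda2_mirror//.
  by rewrite oppr_lt0.
by rewrite oppr_gt0.
Qed.

Lemma A0_closed_mirror (u : R * R) : A0_closed p (mirror u) <-> A0_closed p u.
Proof.
suff H v : A0_closed p v -> A0_closed p (mirror v).
  by split=> [/H|/H//]; rewrite mirrorK.
move=> [v0 v1 v2]; split; rewrite ?lambda1_mirror ?lambda2_mirror//.
  by rewrite oppr_le0.
by rewrite oppr_ge0.
Qed.

Definition sonic_L1 (hat check : R * R -> R) : Prop :=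
  forall u, A0 p u ->
    unique (fun rho => 0 < rho /\ lambda2 p (rho, L1 p rho u) = 0) (check u) /\
    unique (fun rho => 0 < rho /\ lambda1 p (rho, L1 p rho u) = 0) (hat u).

(** The reflection swaps [lambda1] and [lambda2] up to sign, so on the mirrored state [checkr] takes
    the role of the first sonic end and [hatr] that of the second. *)
Lemma sonic_densities_L1 hatl checkl hatr checkr :
  sonic_densities p hatl checkl hatr checkr ->
  sonic_L1 hatl checkl /\ sonic_L1 (checkr \o mirror) (hatr \o mirror).
Proof.
move=> H; split=> u Au; first by have [_ ? _ ?] := H u Au.
have [[[c0 Ec] cu] _ [[h0 Eh] hu] _] := H (mirror u) ((A0_mirror u).2 Au).
have M r : (r, L2rev p r (mirror u)) = mirror (r, L1 p r u).
  by rewrite L2rev_mirror mirrorK.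
have M1 r : lambda1 p (r, L2rev p r (mirror u)) = 0 <->
    lambda2 p (r, L1 p r u) = 0.
  by rewrite M lambda1_mirror; split=> [/eqP|->]; rewrite ?oppr0// oppr_eq0 => /eqP.
have M2 r : lambda2 p (r, L2rev p r (mirror u)) = 0 <->
    lambda1 p (r, L1 p r u) = 0.
  by rewrite M lambda2_mirror; split=> [/eqP|->]; rewrite ?oppr0// oppr_eq0 => /eqP.
split; split.
- by split => //; apply/M1.
- by move=> r [r0 Er]; apply: hu; split => //; apply/M1.
- by split => //; apply/M2.
- by move=> r [r0 Er]; apply: cu; split => //; apply/M2.
Qed.

(** Galilean invariance: subtracting [e] from the initial velocity subtracts [e] from the velocity
    along the entire curve, and thus from both eigenvalues. *)
Lemma L1_shift (r ro qo e : R) : 0 < ro ->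
  L1 p r (ro, qo - e * ro) = L1 p r (ro, qo) - e * r.
Proof.
move=> ro0; have E : r / ro * (qo - e * ro) = r / ro * qo - e * r.
  by field; rewrite gt_eqF.
by rewrite /L1; case: ifP => _; rewrite E; ring.
Qed.

Variables (hat check : R * R -> R).
Hypothesis sonic : sonic_L1 hat check.
Variable u : R * R.
Hypothesis Au : A0 p u.
Local Notation L r := (L1 p r u).
Local Notation h := (hat u).
Local Notation k := (check u).

(** The position of the first sonic end follows from the monotonicity of [lambda1]. For the second,
    uniqueness of the zero of [lambda2] is applied to all the shifted data, which supplies the
    hypothesis of [unique_crossing] on positive levels. *)
Lemma branch_ends : [/\ 0 < h, h < u.1, u.1 < k,
  (forall r, 0 < r -> r < k -> 0 < lambda2 p (r, L r)) &
  (forall r, k < r -> lambda2 p (r, L r) < 0)].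
Proof.
move: Au (sonic Au); case: u => ro qo [/= ro0 l1 l2] [[[k0 Ek] ku] [[h0 Eh] hu]].
have start : L1 p ro (ro, qo) = qo by exact: L1_start.
have hro : hat (ro, qo) < ro.
  have [//|rh] := ltP; exfalso.
  move: rh; rewrite le_eqVlt => /predU1P[rh|rh].
    by move: Eh; rewrite -rh start => l1'; rewrite l1' ltxx in l1.
  have := lambda1_L1_lt pp qo ro0 ro0 rh; rewrite start Eh => l1'.
  by have := lt_trans l1 l1'; rewrite ltxx.
pose f r := lambda2 p (r, L1 p r (ro, qo)).
have fro : f ro = lambda2 p (ro, qo) by rewrite /f start.
have fc x : 0 < x -> {for x, continuous f} by move=> x0; apply: lambda2_L1_cts.
(* Up to the first sonic end [lambda1] is nonnegative, which forces [lambda2] to be positive. *)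
have fh r : 0 < r -> r <= hat (ro, qo) -> 0 < f r.
  move=> r0 rh; have : 0 <= lambda1 p (r, L1 p r (ro, qo)).
    move: rh; rewrite le_eqVlt => /predU1P[->|rh]; first by rewrite Eh.
    by have := lambda1_L1_lt pp qo ro0 r0 rh; rewrite Eh => /ltW.
  have c0 := sound_gt0 pp r0.
  by rewrite /f /lambda1 /lambda2/= subr_ge0 => H; rewrite addr_gt0// (lt_le_trans c0).
have fu e : 0 <= e -> e < f ro -> forall x y, 0 < x -> 0 < y ->
    f x = e -> f y = e -> x = y.
  move=> e0 e1 x y x0 y0 fx fy.
  (* The shift keeps [lambda1] negative because [e] is nonnegative, and [lambda2] positive because
     [e] is below its value at the datum. This is the origin of the range of levels. *)
  have Ae : A0 p (ro, qo - e * ro).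
    have E : (qo - e * ro) / ro = qo / ro - e by field; rewrite gt_eqF.
    move: e1 l1; rewrite fro /lambda1 /lambda2/= => e1 l1.
    by split; [exact: ro0|rewrite /lambda1/= E; lra|rewrite /lambda2/= E; lra].
  have [[_ ue] _] := sonic Ae.
  have fe r : 0 < r -> f r = e -> lambda2 p (r, L1 p r (ro, qo - e * ro)) = 0.
    move=> r0; rewrite /f L1_shift// /lambda2/= => <-.
    by field; rewrite gt_eqF.
  exact: etrans (esym (ue x (conj x0 (fe x x0 fx)))) (ue y (conj y0 (fe y y0 fy))).
have fro0 : 0 < f ro by rewrite fro.
by have [] := unique_crossing h0 hro fc fh fro0 fu k0 Ek.
Qed.

Lemma branch_closed (r : R) : A0_closed p (r, L r) <-> h <= r <= k.
Proof.
have [h0 hu uk l2p l2n] := branch_ends.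
have [[[k0 Ek] _] [[_ Eh] _]] := sonic Au.
have ro0 : 0 < u.1 by case: Au.
have lt1 (x y : R) : 0 < x -> x < y -> lambda1 p (y, L y) < lambda1 p (x, L x).
  by move: ro0; case: u => ro qo /= ro0; exact: lambda1_L1_lt.
split=> [[/= r0 l1 l2]|/andP[hr rk]].
  apply/andP; split; rewrite leNgt; apply/negP => lt.
    by have := lt1 _ _ r0 lt; rewrite Eh ltNge l1.
  by have := l2n _ lt; rewrite ltNge l2.
have r0 := lt_le_trans h0 hr; split => //.
  move: hr; rewrite le_eqVlt => /predU1P[<-|hr]; first by rewrite Eh.
  by have := lt1 _ _ h0 hr; rewrite Eh => /ltW.
move: rk; rewrite le_eqVlt => /predU1P[->|rk]; first by rewrite Ek.
exact/ltW/l2p.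
Qed.

Lemma branch_lt (r t : R) : h <= r -> r < t ->
  L t < L r /\ flow p (r, L r) < flow p (t, L t).
Proof.
have [h0 hu uk _ _] := branch_ends; move=> hr rt.
have l1 : lambda1 p (r, L r) <= 0.
  have ro0 : 0 < u.1 by case: Au.
  have [_ [[_ Eh] _]] := sonic Au.
  move: hr; rewrite le_eqVlt => /predU1P[<-|hr]; first by rewrite Eh.
  rewrite -Eh ltW//.
  by move: ro0 h0 hr; case: u => ro qo /= ro0 h0 hr; exact: lambda1_L1_lt.
move: l1; case: Au => ro0 sub _; have r0 := lt_le_trans h0 hr.
move: ro0 sub; clear -pp r0 rt; case: u => ro qo /= ro0 sub.
exact: L1_flow_lt.
Qed.

Lemma branch_hat_gt0 : 0 < L h.
Proof.
have [h0 _ _ _ _] := branch_ends; have [_ [[_ /eqP]]] := sonic Au.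
rewrite /lambda1/= subr_eq0 => /eqP E _.
by have := sound_gt0 pp h0; rewrite -E pmulr_lgt0 ?invr_gt0.
Qed.

Lemma branch_check_lt0 : L k < 0.
Proof.
have [_ hu uk _ _] := branch_ends; have [[[k0 /eqP]]] := sonic Au.
rewrite /lambda2/= addrC addr_eq0 => /eqP E _ _.
by have := sound_gt0 pp k0; rewrite E oppr_gt0 pmulr_llt0 ?invr_gt0.
Qed.

Lemma branch_cts (r : R) : 0 < r -> {for r, continuous (fun r => L r)} /\
  {for r, continuous (fun r => flow p (r, L r))}.
Proof.
case: Au; case: u => ro qo /= ro0 _ _ r0.
by split; [exact: L1_cts|exact: flow_L1_cts].
Qed.

End SubsonicBranch.

(** * Test functions: support, bounds, derivatives along rays *)

Section TestFunctions.
Variable R : realType.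
Local Notation dt phi := ('D_((1 : R), (0 : R)) phi).
Local Notation dx phi := ('D_((0 : R), (1 : R)) phi).
Variable phi : R * R -> R.
Hypothesis tphi : test_function phi.

Lemma MVT_abs (f df : R -> R) (t h : R) :
  (forall x : R, is_derive x 1 f (df x)) ->
  exists2 z, `|z - t| <= `|h| & f (t + h) - f t = df z * h.
Proof.
move=> fd; have cf (a b : R) : {within `[a, b], continuous f}.
  by apply: within_itvcc => x _; exact: is_derive_cts (fd x).
have [h0|h0|->] := ltgtP h 0.
- have th : t + h < t by rewrite gtrDl.
  have [z] := @MVT _ f df (t + h) t th (fun x _ => fd x) (cf _ _).
  rewrite in_itv/= => /andP[hz zt] E; exists z.
    by rewrite ltr0_norm ?subr_lt0// ltr0_norm//; lra.
  by rewrite -opprB E; ring.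
- have th : t < t + h by rewrite ltrDl.
  have [z] := @MVT _ f df t (t + h) th (fun x _ => fd x) (cf _ _).
  rewrite in_itv/= => /andP[hz zt] E; exists z.
    by rewrite gtr0_norm ?subr_gt0// gtr0_norm//; lra.
  by rewrite E; ring.
- by exists t; [rewrite subrr|rewrite addr0 subrr mulr0].
Qed.

Lemma test_dt (t x : R) : is_derive t 1 (fun s => phi (s, x)) (dt phi (t, x)).
Proof.
have [d _ _ _ _] := tphi; have [dp _] := d (t, x).
have E : (fun h : R => h^-1 *: ((phi \o shift (t, x)) (h *: ((1 : R), (0 : R))) - phi (t, x)))
   = (fun h : R => h^-1 *: (((fun s => phi (s, x)) \o shift t) (h *: (1 : R)) - phi (t, x))).
  apply/funext => h /=; congr (_ *: (phi _ - _)).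
  apply/pair_equal_spec; split; first by [].
  by change (h *: (0 : R) + x = x); rewrite scaler0 add0r.
split; first by move: dp; rewrite /derivable E.
by rewrite /derive E.
Qed.

Lemma test_dx (t x : R) : is_derive x 1 (fun y => phi (t, y)) (dx phi (t, x)).
Proof.
have [d _ _ _ _] := tphi; have [_ dp] := d (t, x).
have E : (fun h : R => h^-1 *: ((phi \o shift (t, x)) (h *: ((0 : R), (1 : R))) - phi (t, x)))
   = (fun h : R => h^-1 *: (((fun s => phi (t, s)) \o shift x) (h *: (1 : R)) - phi (t, x))).
  apply/funext => h /=; congr (_ *: (phi _ - _)).
  apply/pair_equal_spec; split; last by [].
  by change (h *: (0 : R) + t = t); rewrite scaler0 add0r.
split; first by move: dp; rewrite /derivable E.
by rewrite /derive E.
Qed.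

Let K := closure [set z | phi z != 0].

Let out_K z : ~ K z -> [/\ phi z = 0, dt phi z = 0 & dx phi z = 0].
Proof.
move=> nK; have cK : closed K := @closed_closure _ _.
have n0 : \forall y \near z, phi y = 0.
  have : nbhs z (~` K) by apply: open_nbhs_nbhs; split => //; exact: closed_openC.
  apply: filterS => y nKy; apply/eqP; rewrite -[_ == _]negbK; apply/negP => py.
  by apply: nKy; exact: subset_closure.
have n0' : \forall y \near z, phi y = cst 0 y by [].
split; first exact: nbhs_singleton n0.
  by rewrite (near_eq_derive _ n0') derive_cst.
by rewrite (near_eq_derive _ n0') derive_cst.
Qed.

Lemma test_x0 t : phi (t, 0) = 0.
Proof.
have nK : ~ K (t, 0).
  by move=> Kt; have [_ _ _ _ /(_ _ Kt)] := tphi; rewrite /= eqxx => -[].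
by have [] := out_K nK.
Qed.

Lemma test_support : exists t0 t1 X : R, [/\ 0 < t0, t0 < t1, 0 < X &
  forall t x, ~~ [&& t0 <= t, t <= t1 & `|x| <= X] ->
    [/\ phi (t, x) = 0, dt phi (t, x) = 0 & dx phi (t, x) = 0]].
Proof.
have [_ _ _ cK KP] := tphi.
have [[z0 Kz0]|K0] := pselect (exists z, K z); last first.
  exists 1, 2, 1; split; rewrite ?ltr1n// => t x _; apply: out_K => Kt.
  by apply: K0; exists (t, x).
have Kne : K !=set0 by exists z0.
have c1 : {within K, continuous (fst : R * R -> R)}.
  by apply: continuous_subspaceT => z; exact: cvg_fst.
have c2 : {within K, continuous (fun z : R * R => `|z.2|)}.
  by apply: continuous_subspaceT => z; apply: cvg_norm; exact: cvg_snd.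
have [m Km mP] := compact_EVT_min Kne cK c1.
have [m1 Km1 m1P] := compact_EVT_max Kne cK c1.
have [m2 Km2 m2P] := compact_EVT_max Kne cK c2.
have m0 : 0 < m.1 by have [] := KP _ (set_mem Km).
have mm : m.1 <= m1.1 by apply: m1P.
(* The added units make the box nondegenerate whatever the shape of the support. *)
exists m.1, (m1.1 + 1), (`|m2.2| + 1); split => //.
  by apply: (le_lt_trans mm); rewrite ltrDl.
move=> t x H; apply: out_K => Kt; move/negP: H; apply; apply/and3P; split.
- exact: (mP (t, x) (mem_set Kt)).
- by rewrite (le_trans (m1P (t, x) (mem_set Kt)))// lerDl.
- by rewrite (le_trans (m2P (t, x) (mem_set Kt)))// lerDl.
Qed.

Lemma test_bounded : exists2 M : R, 0 <= M &
  forall z, `|dt phi z| <= M /\ `|dx phi z| <= M.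
Proof.
have [_ ct cx cK _] := tphi.
have bd (f : R * R -> R) : continuous f -> (forall z, ~ K z -> f z = 0) ->
    exists2 M, 0 <= M & forall z, `|f z| <= M.
  move=> cf f0; have [Kne|K0] := pselect (K !=set0); last first.
    exists 0 => // z; rewrite f0 ?normr0// => Kz; by apply: K0; exists z.
  have cn : {within K, continuous (fun z => `|f z|)}.
    by apply: continuous_subspaceT => z; apply: cvg_norm; exact: cf.
  have [m Km mP] := compact_EVT_max Kne cK cn.
  exists `|f m| => // z; have [Kz|nKz] := pselect (K z); first exact: mP (mem_set Kz).
  by rewrite f0// normr0.
have [z nz|Mt Mt0 MtP] := bd _ ct; first by have [] := out_K nz.
have [z nz|Mx Mx0 MxP] := bd _ cx; first by have [] := out_K nz.
exists (Mt + Mx) => [|z]; first exact: addr_ge0.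
by rewrite (le_trans (MtP z)) ?lerDl// (le_trans (MxP z)) ?lerDr.
Qed.

Lemma test_le (M : R) : (forall z, `|dx phi z| <= M) ->
  forall t x, `|phi (t, x)| <= M * `|x|.
Proof.
move=> MP t x; have [z _] := MVT_abs 0 x (test_dx t).
rewrite add0r test_x0 subr0 => ->.
by rewrite normrM ler_wpM2r.
Qed.

(** A chain rule from continuous partial derivatives: the increment along the ray is split into a
    step in [t] at the new abscissa, handled by the mean value theorem and the continuity of the
    time derivative, and a step in [x] at fixed time. *)
Lemma test_ray (xi t : R) : is_derive t 1 (fun s => phi (s, s * xi))
  (dt phi (t, t * xi) + xi * dx phi (t, t * xi)).
Proof.
have [_ ct _ _ _] := tphi.
have d2 : is_derive t 1 (fun s => phi (t, s * xi)) (xi * dx phi (t, t * xi)).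
  have d1 : is_derive t 1 (fun s : R => s * xi) xi.
    by apply: is_derive_eq; rewrite /GRing.scale/=; ring.
  have := @is_derive1_comp _ (fun y => phi (t, y)) (fun s => s * xi) t _ _
    (test_dx t (t * xi)) d1.
  by rewrite mulrC.
apply/is_derive1P; move/is_derive1P : d2 => d2.
have -> : (fun h : R => h^-1 * (phi (t + h, (t + h) * xi) - phi (t, t * xi))) =
  (fun h : R => h^-1 * (phi (t + h, (t + h) * xi) - phi (t, (t + h) * xi))
     + h^-1 * (phi (t, (t + h) * xi) - phi (t, t * xi))).
  by apply/funext => h; rewrite -mulrDr addrA subrK.
apply: cvgD => //; apply/cvgrPdist_le => e e0.
have /cvgrPdist_le/(_ e e0)/nbhs_ballP[d /= d0 dP] := ct (t, t * xi).
(* The intermediate point is off by at most [|h|] in time and [|h| * |xi|] in space; this radius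
   puts both below [d]. *)
have dxi : 0 < d / (1 + `|xi|) by rewrite divr_gt0// ltr_wpDr.
have H1 : \forall h \near (0 : R)^', `|h| < d / (1 + `|xi|) by exact: dnbhs0_lt.
have H2 : \forall h \near (0 : R)^', h != 0 by exact: nbhs_dnbhs_neq.
near=> h.
have h0 : h != 0 by near: h.
have hd : `|h| * (1 + `|xi|) < d by rewrite -ltr_pdivlMr ?ltr_wpDr//; near: h.
have [z zt ->] := MVT_abs t h (fun x => test_dt x ((t + h) * xi)).
rewrite [_ * h]mulrC mulKf//; apply: dP; split => /=; rewrite /ball/=.
  rewrite distrC (le_lt_trans zt)//; apply: le_lt_trans hd.
  by rewrite ler_peMr// lerDl.
rewrite -mulrBl opprD addrA subrr sub0r normrM normrN; apply: le_lt_trans hd.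
by rewrite ler_wpM2l// lerDr.
Unshelve. all: end_near. Qed.

Lemma test_cts : [/\ continuous (dt phi), continuous (dx phi) &
  forall t xi : R, {for xi, continuous (fun xi : R => phi (t, t * xi))}].
Proof.
have [_ ct cx _ _] := tphi; split => // t xi.
apply: (@continuous_comp _ _ _ (fun x : R => t * x) (fun y => phi (t, y))).
  by apply: cvgM; [exact: cvg_cst|exact: cvg_id].
exact: is_derive_cts (test_dx t _).
Qed.

End TestFunctions.

(** * Integrals over adjacent intervals *)

Section IntegralPieces.
Variable R : realType.
Local Notation mu := (@lebesgue_measure R).

(** End points are negligible. This frees the sectors from the value that a wave takes exactly at a
    shock. *)
Lemma eq_itvoo_Rintegral (f g : R -> R) (a b : R) :
  (forall x, a < x < b -> f x = g x) -> mu.-integrable `[a, b] (EFin \o g) ->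
  mu.-integrable `[a, b] (EFin \o f) /\
  \int[mu]_(x in `[a, b]) f x = \int[mu]_(x in `[a, b]) g x.
Proof.
move=> fg /integrableP[/measurable_EFinP mg ig].
have moo (h : R -> R) : measurable_fun `[a, b] h -> measurable_fun `]a, b[ h.
  by apply: measurable_funS => //; exact: subset_itv_oo_cc.
have mf : measurable_fun `[a, b] f.
  apply: (@measurable_fun_itv_cc _ _ _ false true).
  apply: eq_measurable_fun (moo _ mg) => x.
  by rewrite inE/= in_itv/= => /fg.
have E (F : R -> \bar R) (G : R -> \bar R) : measurable_fun `[a, b] F ->
    measurable_fun `[a, b] G -> (forall x, a < x < b -> F x = G x) ->
    (\int[mu]_(x in `[a, b]) F x = \int[mu]_(x in `[a, b]) G x)%E.
  move=> mF mG FG; rewrite !integral_itv_bndoo//.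
  - by apply: eq_integral => x; rewrite inE/= in_itv/=; exact: FG.
  - by apply: measurable_funS mG => //; exact: subset_itv_oo_cc.
  - by apply: measurable_funS mF => //; exact: subset_itv_oo_cc.
split; last first.
  by congr fine; apply: E; [exact/measurable_EFinP..|move=> x /fg ->].
apply/integrableP; split; first exact/measurable_EFinP.
rewrite (E _ (fun x => `|(EFin \o g) x|%E))//.
- by apply: measurableT_comp => //; exact/measurable_EFinP.
- by apply: measurableT_comp => //; exact/measurable_EFinP.
- by move=> x /fg /= ->.
Qed.

Lemma glue_itv_Rintegral (f : R -> R) (a b c : R) : a <= b -> b <= c ->
  mu.-integrable `[a, b] (EFin \o f) -> mu.-integrable `[b, c] (EFin \o f) ->
  mu.-integrable `[a, c] (EFin \o f) /\
  \int[mu]_(x in `[a, c]) f x =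
    \int[mu]_(x in `[a, b]) f x + \int[mu]_(x in `[b, c]) f x.
Proof.
move=> ab bc iab ibc.
have ibc' : mu.-integrable `]b, c] (EFin \o f).
  by apply: integrableS ibc => //; exact: subset_itv_oc_cc.
have E : (`[a, c] = `[a, b] `|` `]b, c])%classic.
  by rewrite -itv_bndbnd_setU// bnd_simp.
have dis : [disjoint `[a, b]%classic & `]b, c]%classic].
  apply/disj_setPS => y [/=]; rewrite 2!in_itv/= => /andP[_ yx] /andP[].
  by rewrite ltNge yx.
have mf : measurable_fun `[a, c] (EFin \o f).
  by rewrite E; apply/measurable_funU => //; split; [move/integrableP: iab => []|
    move/integrableP : ibc' => []].
have iac : mu.-integrable `[a, c] (EFin \o f).
  apply/integrableP; split => //; rewrite E ge0_integral_setU//.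
    by apply: lte_add_pinfty; [move/integrableP: iab => []|
      move/integrableP : ibc' => []].
  by rewrite -E; exact: measurableT_comp.
split => //; rewrite E Rintegral_setU//; last by rewrite -E.
by rewrite [X in _ + X = _]Rintegral_itv_obnd_cbnd.
Qed.

End IntegralPieces.

(** * The weak identity on a sector *)

Section Pieces.
Variable R : realType.
Local Notation mu := (@lebesgue_measure R).
Local Notation dt phi := ('D_((1 : R), (0 : R)) phi).
Local Notation dx phi := ('D_((0 : R), (1 : R)) phi).
Variable phi : R * R -> R.
Hypothesis tphi : test_function phi.
Implicit Types W f : R -> R.

Definition weak_integrand W f (t x : R) : R :=
  W (x / t) * dt phi (t, x) + f (x / t) * dx phi (t, x).

(* The sector a < x / t < b contributes an exact time derivative and the
   boundary fluxes ga, gb, which are the values of f - xi W at its sides. *)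
Definition sector W f (a b ga gb : R) : Prop :=
  exists J J' : R -> R,
  [/\ forall t : R, 0 < t -> is_derive t 1 J (J' t),
      forall t, 0 < t -> {for t, continuous J'},
      forall t, (forall x, phi (t, x) = 0) -> J t = 0 &
      forall t, 0 < t ->
        mu.-integrable `[t * a, t * b] (EFin \o weak_integrand W f t) /\
        \int[mu]_(x in `[t * a, t * b]) weak_integrand W f t x =
          J' t + (gb * phi (t, t * b) - ga * phi (t, t * a))].

Lemma sector_ext W f W' f' (a b ga gb : R) :
  (forall xi, a < xi < b -> W xi = W' xi /\ f xi = f' xi) ->
  sector W' f' a b ga gb -> sector W f a b ga gb.
Proof.
move=> E [J [J' [dJ cJ J0 JI]]]; exists J, J'; split => // t t0.
have [iI <-] := JI t t0.
have H x : t * a < x < t * b -> weak_integrand W f t x = weak_integrand W' f' t x.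
  move=> /andP[h1 h2]; have /E[E1 E2] : a < x / t < b.
    by rewrite ltr_pdivlMr// ltr_pdivrMr// ![_ * t]mulrC h1.
  by rewrite /weak_integrand E1 E2.
exact: eq_itvoo_Rintegral H iI.
Qed.

Lemma sector_point W f (a g : R) : sector W f a a g g.
Proof.
exists (fun=> 0), (fun=> 0); split => //.
- by move=> t _; exact: is_derive_cst.
- by move=> t _; exact: cvg_cst.
- move=> t _; rewrite set_itv1 Rintegral_set1 subrr addr0; split => //.
  by rewrite -set_itv1; apply: integrable_itvcc; rewrite set_itv1; exact: continuous_subspace1.
Qed.

Lemma sector_glue W f (a b c ga gb gc : R) : a <= b -> b <= c ->
  sector W f a b ga gb -> sector W f b c gb gc -> sector W f a c ga gc.
Proof.
move=> ab bc [J [J' [dJ cJ J0 JI]]] [K [K' [dK cK K0 KI]]].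
exists (fun t => J t + K t), (fun t => J' t + K' t); split.
- by move=> t t0; apply: is_deriveD; [exact: dJ|exact: dK].
- by move=> t t0; apply: cvgD; [exact: cJ|exact: cK].
- by move=> t p0; rewrite J0// K0// addr0.
- move=> t t0; have [iJ EJ] := JI t t0; have [iK EK] := KI t t0.
  have tab : t * a <= t * b by rewrite ler_pM2l.
  have tbc : t * b <= t * c by rewrite ler_pM2l.
  have [iI ->] := glue_itv_Rintegral tab tbc iJ iK.
  by split => //; rewrite EJ EK; ring.
Qed.

(** On the axis the flux multiplies [phi (t, 0) = 0], so its value may be replaced at will. This is
    what allows waves with different fluxes at the junction to be glued. *)
Lemma sector_axisr W f (a ga gb gb' : R) :
  sector W f a 0 ga gb -> sector W f a 0 ga gb'.
Proof.
move=> [J [J' [dJ cJ J0 JI]]]; exists J, J'; split => // t t0.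
have [iI ->] := JI t t0; split => //.
by rewrite mulr0 (test_x0 tphi) !mulr0.
Qed.

(** In the variable [xi = x / t] the integrand becomes [t * (W * phi_t + f * phi_x)], which is the
    time derivative of [W * t * phi] plus the [xi] derivative of [G * phi], with [G = f - xi * W].
    The first is the derivative of [J] by differentiation under the integral sign, the second
    integrates to the boundary terms. *)
Lemma sector_smooth W f (a b : R) : a < b ->
  {within `[a, b], continuous W} -> {within `[a, b], continuous f} ->
  (forall xi, a < xi < b ->
    is_derive xi 1 (fun xi => f xi - xi * W xi) (- W xi)) ->
  sector W f a b (f a - a * W a) (f b - b * W b).
Proof.
move=> ab cW cf dG.
have [ct cx cr] := test_cts tphi.
have [M M0 MP] := test_bounded tphi.
pose ray t xi := dt phi (t, t * xi) + xi * dx phi (t, t * xi).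
have dray (t xi : R) : is_derive t 1 (fun s => phi (s, s * xi)) (ray t xi).
  exact: test_ray.
(* The factor [t] is the Jacobian of [x = t * xi], so [J t] is the space integral of [W * phi] over
   the sector. *)
pose P t xi := W xi * (t * phi (t, t * xi)).
pose P' t xi := W xi * (phi (t, t * xi) + t * ray t xi).
have dP (t xi : R) : is_derive t 1 (fun s => P s xi) (P' t xi).
  have d := dray t xi; apply: is_derive_eq.
  by rewrite /P' /GRing.scale/=; ring.
have cid (t : R) : {within `[a, b], continuous (fun xi : R => t * xi)}.
  by apply: continuous_subspaceT => x; apply: cvgM; [exact: cvg_cst|exact: cvg_id].
have cphi (t : R) : {within `[a, b], continuous (fun xi => phi (t, t * xi))}.
  by apply: continuous_subspaceT => x; exact: cr.
have cline (F : R * R -> R) (t : R) : continuous F ->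
    continuous (fun xi : R => F (t, t * xi)).
  move=> cF x; apply: (@continuous_comp _ _ _ (fun xi : R => (t, t * xi)) F).
    apply: (@cvg_pair _ _ _ _ (nbhs t) (nbhs (t * x))); first exact: cvg_cst.
    by apply: cvgM; [exact: cvg_cst|exact: cvg_id].
  exact: cF.
have cray (t : R) : {within `[a, b], continuous (ray t)}.
  apply: continuous_subspaceT => x; apply: cvgD; first exact: (cline _ t ct).
  by apply: cvgM; [exact: cvg_id|exact: (cline _ t cx)].
have cP (t : R) : {within `[a, b], continuous (P t)}.
  move=> x; apply: cvgM; first exact: cW.
  by apply: cvgM; [exact: cvg_cst|exact: cphi].
have cP' (t : R) : {within `[a, b], continuous (P' t)}.
  move=> x; apply: cvgM; first exact: cW.
  by apply: cvgD; [exact: cphi|apply: cvgM; [exact: cvg_cst|exact: cray]].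
have [C C0 CP] : exists2 C : R, 0 <= C & forall xi, a <= xi <= b -> `|W xi| <= C /\ `|xi| <= C.
  have abK : compact `[a, b] by exact: segment_compact.
  have cn : {within `[a, b], continuous (fun xi => `|W xi|)}.
    by move=> x; apply: cvg_norm; exact: cW.
  have [m _ mP] := EVT_max (ltW ab) cn.
  exists (`|W m| + (`|a| + `|b|)) => [|xi xab]; first by rewrite !addr_ge0.
  split; first by rewrite ler_wpDr ?addr_ge0// mP// in_itv.
  rewrite ler_wpDl// ler_norml; move: xab => /andP[ax xb].
  have Ha := ler_norm (- a); rewrite normrN in Ha.
  have Hb := ler_norm b; have Ha0 := normr_ge0 a; have Hb0 := normr_ge0 b.
  by apply/andP; split; lra.
(* A bound for [P'] at all times in []0, v[]: the value of [phi] at [x = t * xi] is at most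
   [M * |x|], since [phi] vanishes on the axis, and its derivative along the ray is at most
   [M + C * M]. *)
pose B v := C * (M * (v * C) + v * (M + C * M)).
have P'B t xi v : 0 < t -> t < v -> a <= xi <= b -> `|P' t xi| <= B v.
  move=> t0 tv xab; have [WC xC] := CP xi xab.
  have v0 := lt_trans t0 tv.
  rewrite normrM; apply: ler_pM => //; apply: le_trans (ler_normD _ _) _.
  apply: lerD.
    apply: le_trans (test_le tphi (fun z => (MP z).2) _ _) _.
    by rewrite ler_wpM2l// normrM gtr0_norm// ler_pM// ltW.
  rewrite normrM gtr0_norm// ler_pM ?(ltW t0) ?(ltW tv)//.
  apply: le_trans (ler_normD _ _) _; apply: lerD; first exact: (MP _).1.
  by rewrite normrM ler_pM//; exact: (MP _).2.
have iB v : mu.-integrable `[a, b] (EFin \o (fun=> B v)).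
  by apply: integrable_itvcc; apply: continuous_subspaceT => x; exact: cvg_cst.
have B0 v : 0 < v -> 0 <= B v.
  by move=> v0; rewrite mulr_ge0// addr_ge0// ?mulr_ge0// ?addr_ge0 ?mulr_ge0// ltW.
pose J t := \int[mu]_(xi in `[a, b]) P t xi.
pose J' t := \int[mu]_(xi in `[a, b]) P' t xi.
exists J, J'; split.
(* The window from [t / 2] to [t * 2] keeps times positive and bounded, so the constant [B (t * 2)]
   dominates. *)
- move=> t t0; have tI : `](t / 2), (t * 2)[%classic t.
    by rewrite /= in_itv/=; apply/andP; split; lra.
  have pos x : `](t / 2), (t * 2)[%classic x -> 0 < x /\ x < t * 2.
    by rewrite /= in_itv/= => /andP[? ?]; split; lra.
  have iP x : `](t / 2), (t * 2)[%classic x -> mu.-integrable `[a, b] (EFin \o P x).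
    by move=> _; exact: integrable_itvcc.
  have dP1 x y : `](t / 2), (t * 2)[%classic x -> `[a, b]%classic y ->
      derivable (P ^~ y) x 1.
    by move=> _ _; have [] := dP x y.
  have PE x y : partial1of2 P x y = P' x y.
    by rewrite partial1of2E; apply: derive_val; exact: dP.
  have PB x y : `](t / 2), (t * 2)[%classic x -> `[a, b]%classic y ->
      `|partial1of2 P x y| <= B (t * 2).
    by move=> /pos[x0 xt]; rewrite /= in_itv/= => yab; rewrite PE; exact: P'B.
  have B20 (y : R) : 0 <= B (t * 2) by apply: B0; rewrite mulr_gt0.
  have dJ := @derivable_under_integral _ _ _ mu _ _ (measurable_itv _) _ _ _
    tI iP dP1 (fun=> B (t * 2)) B20 (iB _) PB.
  apply: DeriveDef => //; rewrite -derive1E.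
  rewrite (@differentiation_under_integral _ _ _ mu _ _ (measurable_itv _)
    _ _ _ tI iP dP1 (fun=> B (t * 2)) B20 (iB _) PB).
  by apply: eq_Rintegral => y _; rewrite PE.
- move=> t t0; have tI : t \in (`](t / 2), (t * 2)[%classic : set R).
    by rewrite inE /= in_itv/=; apply/andP; split; lra.
  have pos x : `](t / 2), (t * 2)[%classic x -> 0 < x /\ x < t * 2.
    by rewrite /= in_itv/= => /andP[? ?]; split; lra.
  have iP x : `](t / 2), (t * 2)[%classic x -> mu.-integrable `[a, b] (EFin \o P' x).
    by move=> _; exact: integrable_itvcc.
  have cPt : {ae mu, forall y, `[a, b]%classic y ->
      {in (`](t / 2), (t * 2)[%classic : set R), continuous (P' ^~ y)}}.
    apply/aeW => y _ x _; apply: cvgM; first exact: cvg_cst.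
    have cdiag (F : R * R -> R) : continuous F -> {for x, continuous (fun s : R => F (s, s * y))}.
      move=> cF; apply: (@continuous_comp _ _ _ (fun s : R => (s, s * y)) F).
        apply: (@cvg_pair _ _ _ _ (nbhs x) (nbhs (x * y))); first exact: cvg_id.
        by apply: cvgM; [exact: cvg_id|exact: cvg_cst].
      exact: cF.
    apply: cvgD; first exact: is_derive_cts (dray x y).
    apply: cvgM; first exact: cvg_id.
    apply: cvgD; first exact: (cdiag _ ct).
    by apply: cvgM; [exact: cvg_cst|exact: (cdiag _ cx)].
  have PB x : `](t / 2), (t * 2)[%classic x ->
      {ae mu, forall y, `[a, b]%classic y -> `|P' x y| <= (fun=> B (t * 2)) y}.
    by move=> /pos[x0 xt]; apply/aeW => y; rewrite /= in_itv/= => yab; exact: P'B.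
  exact: (@continuity_under_integral _ _ _ mu _ _ (measurable_itv _) _ _
    iP cPt (fun=> B (t * 2)) (iB _) PB _ tI).
- move=> t p0; rewrite /J (@eq_Rintegral _ _ _ _ _ (fun=> 0)).
    by rewrite Rintegral_cst// mul0r.
  by move=> x _; rewrite /P p0 !mulr0.
- move=> t t0.
  have Vt (x : R) : t * x / t = x by rewrite mulrAC divff ?mul1r// gt_eqF.
  have dtx (x : R) : is_derive x 1 (fun xi : R => t * xi) t.
    by apply: is_derive_eq; rewrite /GRing.scale/=; ring.
  have cH : {within `[t * a, t * b], continuous (weak_integrand W f t)}.
    have cdiv : {within `[t * a, t * b], continuous (fun x : R => x / t)}.
      by apply: continuous_subspaceT => x; apply: cvgM; [exact: cvg_id|exact: cvg_cst].
    have div x : `[t * a, t * b]%classic x -> `[a, b]%classic (x / t).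
      by rewrite /= !in_itv/= ler_pdivlMr// ler_pdivrMr// ![_ * t]mulrC.
    have cx' (F : R * R -> R) : continuous F ->
        {within `[t * a, t * b], continuous (fun x : R => F (t, x))}.
      move=> cF; apply: continuous_subspaceT => x.
      apply: (@continuous_comp _ _ _ (fun x : R => (t, x)) F); last exact: cF.
      by apply: (@cvg_pair _ _ _ _ (nbhs t) (nbhs x)); [exact: cvg_cst|exact: cvg_id].
    have cW' := within_comp div cdiv cW; have cf' := within_comp div cdiv cf.
    move=> x; apply: cvgD.
      by apply: cvgM; [exact: cW'|exact: (cx' _ ct)].
    by apply: cvgM; [exact: cf'|exact: (cx' _ cx)].
  split; first exact: integrable_itvcc.
  pose G xi := f xi - xi * W xi.
  have cG : {within `[a, b], continuous G}.
    move=> x; apply: cvgB; first exact: cf.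
    apply: cvgM; last exact: cW.
    exact: (continuous_subspaceT (fun x => cvg_id)).
  (* The derivative of [G * phi] in [xi]. Only the combination [G] is differentiated, never [W] or
     [f] separately. *)
  pose Q xi := - W xi * phi (t, t * xi) + G xi * (t * dx phi (t, t * xi)).
  have cQ : {within `[a, b], continuous Q}.
    move=> x; apply: cvgD.
      by apply: cvgM; [apply: cvgN; exact: cW|exact: cphi].
    apply: cvgM; [exact: cG|apply: cvgM; [exact: cvg_cst|]].
    exact: (continuous_subspaceT (cline _ t cx)).
  have dQ xi : a < xi < b -> is_derive xi 1 (fun xi => G xi * phi (t, t * xi)) (Q xi).
    move=> xab; have d1 := dG xi xab.
    have d2 : is_derive xi 1 (fun xi => phi (t, t * xi)) (t * dx phi (t, t * xi)).
      have := @is_derive1_comp _ (fun y => phi (t, y)) (fun xi => t * xi) xi _ _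
        (test_dx tphi t (t * xi)) (dtx xi).
      by rewrite [dx phi _ * _]mulrC.
    have := is_deriveM d1 d2; rewrite /G => d.
    apply: (@is_derive_eq _ _ _ _ _ _ _ _ d).
    by rewrite /Q /G /GRing.scale/=; ring.
  have IQ : \int[mu]_(xi in `[a, b]) Q xi =
      G b * phi (t, t * b) - G a * phi (t, t * a).
    rewrite /Rintegral (@continuous_FTC2 _ Q (fun xi => G xi * phi (t, t * xi)) a b)//.
      have cGp : {within `[a, b], continuous (fun xi => G xi * phi (t, t * xi))}.
        by move=> x; apply: cvgM; [exact: cG|exact: cphi].
      have [_ Ga Gb] := (continuous_within_itvP _ ab).1 cGp.
      split => // x; rewrite in_itv/= => /dQ[]; by [].
    by move=> x; rewrite in_itv/= => xab; rewrite derive1E; apply: derive_val; exact: dQ.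
  (* The terms in [phi] itself cancel in [P' + Q], as do those in [xi * W], which leaves the weak
     integrand at [t * xi] times the Jacobian. *)
  rewrite -IQ /J' -RintegralD//; [|exact: integrable_itvcc..].
  have S := @integration_by_substitution_increasing R (fun xi => t * xi)
    (weak_integrand W f t) a b (ltW ab).
  have D1 : (fun xi : R => t * xi)^`()%classic = cst t.
    by apply/funext => x; rewrite derive1E; apply: derive_val.
  rewrite /Rintegral S//.
  - congr fine; apply: eq_integral => x _ /=; congr (_%:E).
    rewrite !fctE /= D1 /weak_integrand Vt /P' /ray /Q /G.
    by rewrite /cst; ring.
  - by move=> x y _ _ xy; rewrite ltr_pM2l.
  - by rewrite D1 => x _; exact: cvg_cst.
  - by rewrite D1; exact: is_cvg_cst.
  - by rewrite D1; exact: is_cvg_cst.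
  - have [_ Ga Gb] := (continuous_within_itvP _ ab).1 (cid t).
    by split => // x _; have [] := dtx x.
Qed.

End Pieces.

(** * From sectors to the weak equations *)

Section WeakIdentity.
Variable R : realType.
Local Notation mu := (@lebesgue_measure R).
Local Notation dt phi := ('D_((1 : R), (0 : R)) phi).
Local Notation dx phi := ('D_((0 : R), (1 : R)) phi).
Variable phi : R * R -> R.
Hypothesis tphi : test_function phi.

Lemma sector_const (W f : R -> R) (a b w v : R) : a <= b ->
  (forall xi, a < xi < b -> W xi = w /\ f xi = v) ->
  sector phi W f a b (v - a * w) (v - b * w).
Proof.
rewrite le_eqVlt => /predU1P[<- _|ab E]; first exact: sector_point.
apply: (@sector_ext _ _ _ _ (cst w) (cst v)) => //.
have cc (k : R) : {within `[a, b], continuous (cst k : R -> R)}.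
  by apply: continuous_subspaceT => x; exact: cvg_cst.
apply: (sector_smooth tphi ab (cc w) (cc v)) => xi _ /=.
by apply: is_derive_eq; rewrite /GRing.scale/=; ring.
Qed.

Lemma integral_restrict (A B : set R) (h : R -> \bar R) : A `<=` B ->
  (forall x, B x -> ~ A x -> h x = 0%E) ->
  (\int[mu]_(x in B) h x = \int[mu]_(x in A) h x)%E.
Proof.
move=> AB h0; rewrite integral_mkcond [RHS]integral_mkcond.
apply: eq_integral => x _; rewrite !patchE.
have [xB|xB] := boolP (x \in B); have [xA|xA] := boolP (x \in A) => //.
  by apply: h0; [exact: set_mem|move=> Ax; move: xA; rewrite mem_set].
by move: xB; rewrite mem_set//; apply: AB; exact: set_mem.
Qed.

(** A sector wide enough to contain the support has no boundary terms, so the space integral is the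
    time derivative of [J], and [J] vanishes before and after the support. *)
Lemma weak_identity (W f : R -> R) (U V : R -> R -> R) :
  (forall N0 : R, exists2 N, N0 <= N &
     exists g g', sector phi W f (- N) N g g') ->
  (forall t x, 0 < t -> U t x = W (x / t) /\ V t x = f (x / t)) ->
  (\int[mu]_(t in [set t | 0 <= t]%R) \int[mu]_x
     (U t x * dt phi (t, x) + V t x * dx phi (t, x))%:E = 0)%E.
Proof.
move=> sec UV; have [t0 [t1 [X [t00 t01 X0 out]]]] := test_support tphi.
(* Since [N] exceeds [X / t0], the cone [|x| <= t * N] contains the support at every time [t >= t0],
   with its edges strictly outside; earlier slices of [phi] are zero. *)
have [N NX [g [g' [J [J' [dJ cJ J0 JI]]]]]] := sec (X / t0 + 1).
have N0 : 0 < N by apply: lt_le_trans NX; rewrite ltr_wpDl// divr_ge0// ltW.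
have farx t x : 0 < t -> t * N <= `|x| ->
    [/\ phi (t, x) = 0, dt phi (t, x) = 0 & dx phi (t, x) = 0].
  move=> tp Nx; apply: out; apply/negP => /and3P[t0t _ xX].
  have : X < t * N.
    apply: (@lt_le_trans _ _ (t0 * N)); last by rewrite ler_pM2r.
    rewrite mulrC -ltr_pdivrMr//; apply: lt_le_trans NX.
    by rewrite ltrDl.
  by move=> /lt_le_trans/(_ Nx)/lt_le_trans/(_ xX); rewrite ltxx.
pose inner t := (\int[mu]_x (U t x * dt phi (t, x) + V t x * dx phi (t, x))%:E)%E.
have innerE t : 0 < t -> inner t = (J' t)%:E.
  move=> tp; have [iI EI] := JI t tp.
  have bnd x : `|x| = t * N -> phi (t, x) = 0.
    by move=> xN; have [] // := farx t x tp; rewrite xN.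
  rewrite !bnd ?mulr0 ?subrr ?addr0 in EI.
  - rewrite -EI /Rintegral fineK; last exact: integrable_fin_num.
    rewrite /inner (@integral_restrict (`[t * - N, t * N])%classic)//.
      apply: eq_integral => x _.
      by have [-> ->] := UV t x tp.
    move=> x _; rewrite /= in_itv/= mulrN -ler_norml => /negP; rewrite -ltNge => xN.
    by have [_ -> ->] := farx t x tp (ltW xN); rewrite !mulr0 addr0.
  - by rewrite mulrN normrN gtr0_norm// mulr_gt0.
  - by rewrite gtr0_norm// mulr_gt0.
have inner0 t : ~~ (t0 <= t <= t1) -> inner t = 0%E.
  move=> tout; rewrite /inner integral0_eq// => x _.
  have [|_ -> ->] := out t x; last by rewrite !mulr0 addr0.
  by apply: contra tout => /and3P[-> ->].
(* Both times lie strictly outside [[t0, t1]], so that [J] is 0 there, and [s0] is positive, since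
   the sector identity is available only for positive times. *)
pose s0 := t0 / 2; pose s1 := t1 + 1.
have s00 : 0 < s0 by rewrite divr_gt0.
have s0t : s0 < t0 by rewrite ltr_pdivrMr// ltr_pMr// ltr1n.
have s1t : t1 < s1 by rewrite ltrDl.
have s01 : s0 < s1 by rewrite (lt_trans s0t)// (lt_trans t01).
rewrite (@integral_restrict (`[s0, s1])%classic); last 2 first.
- by move=> t /=; rewrite in_itv/= => /andP[+ _]; apply: le_trans; exact: ltW.
- move=> t _; rewrite /= in_itv/= => tout; apply: inner0; apply/negP => /andP[h1 h2].
  by apply: tout; rewrite (le_trans (ltW s0t))//= (le_trans h2)// ltW.
have pos t : s0 <= t <= s1 -> 0 < t by move=> /andP[+ _]; exact: lt_le_trans.
transitivity (\int[mu]_(t in `[s0, s1]) (J' t)%:E)%E.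
  by apply: eq_integral => t; rewrite inE/= in_itv/= => /pos; exact: innerE.
have cJ' : {within `[s0, s1], continuous J'}.
  by apply: within_itvcc => t /pos; exact: cJ.
have cJJ : {within `[s0, s1], continuous J}.
  by apply: within_itvcc => t /pos tp; exact: is_derive_cts (dJ t tp).
rewrite (@continuous_FTC2 _ J' J s0 s1)//.
- rewrite !J0 ?subee//.
  + by move=> x; have [] // := out s0 x; rewrite leNgt s0t.
  + by move=> x; have [] // := out s1 x; rewrite [s1 <= t1]leNgt s1t andbF.
- have [_ Ga Gb] := (continuous_within_itvP _ s01).1 cJJ.
  split => // t; rewrite in_itv/= => /andP[h1 h2].
  by have [] := dJ t (lt_trans s00 h1).
- move=> t; rewrite in_itv/= => /andP[h1 h2]; rewrite derive1E.
  by apply: derive_val; exact: dJ (lt_trans s00 h1).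
Qed.

End WeakIdentity.

(** * Almost everywhere statements on the line *)

Section AlmostEverywhere.
Variable R : realType.
Local Notation mu := (@lebesgue_measure R).

Lemma ae_imply2 (P Q S : R -> Prop) : (forall x, P x -> Q x -> S x) ->
  {ae mu, forall x, P x} -> {ae mu, forall x, Q x} -> {ae mu, forall x, S x}.
Proof. by move=> PQ; apply: filterS2; first exact: (ae_filter_ringOfSetsType mu). Qed.

Lemma ae_itvoo (a b : R) (P : R -> Prop) : a < b -> {ae mu, forall x, P x} ->
  exists2 x, a < x < b & P x.
Proof.
move=> ab [N [mN N0 PN]]; apply: contrapT => nex.
have sub : `]a, b[%classic `<=` N.
  move=> x; rewrite /= in_itv/= => xab; apply: PN => Px.
  by apply: nex; exists x.
have : (mu `]a, b[%classic <= mu N)%E by apply: le_measure => //; rewrite inE.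
rewrite N0 lebesgue_measure_itv/= lte_fin ab -EFinD lee_fin.
by rewrite leNgt subr_gt0 ab.
Qed.

End AlmostEverywhere.

(** * Self-similar profiles: bounded variation and continuity in time *)

Section Profiles.
Variable R : realType.
Local Notation mu := (@lebesgue_measure R).
Implicit Types U : R -> R.

(** Each clause serves one requirement on a solution: the Jordan decomposition into bounded monotone
    functions gives measurability and bounded variation, the constant tails give the initial datum
    as [t] tends to 0, and continuity off a finite list gives pointwise convergence almost
    everywhere as [t] varies. *)
Definition profile U (A B : R) : Prop :=
  exists (f g : R -> R) (D : seq R) (N M : R),
  [/\ {homo f : x y / x <= y} /\ {homo g : x y / x <= y},
      forall x, `|f x| <= M /\ `|g x| <= M,
      forall x, U x = f x - g x,
      0 < N /\ forall x, (x <= - N -> U x = A) /\ (N <= x -> U x = B) &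
      forall x, x \notin D -> {for x, continuous U}].

Lemma profile_homo U (A B : R) (D : seq R) (N : R) :
  {homo U : x y / x <= y} -> 0 < N ->
  (forall x, x <= - N -> U x = A) -> (forall x, N <= x -> U x = B) ->
  (forall x, x \notin D -> {for x, continuous U}) -> profile U A B.
Proof.
move=> mU N0 UA UB cU; exists U, (fun=> 0), D, N, (`|A| + `|B|); split.
- by split=> // x y _.
- move=> x; split; last by rewrite normr0 addr_ge0.
  have h1 : A <= U x.
    have [xN|/ltW Nx] := leP x (- N); first by rewrite UA.
    by rewrite -(UA (- N))// mU.
  have h2 : U x <= B.
    have [Nx|/ltW xN] := leP N x; first by rewrite UB.
    by rewrite -(UB N)// mU.
  have := ler_norm (- A); have := ler_norm B; rewrite normrN => hB hA.
  have := normr_ge0 A; have := normr_ge0 B => ? ?.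
  by rewrite ler_norml; apply/andP; split; lra.
- by move=> x; rewrite subr0.
- by split => // x; split; [exact: UA|exact: UB].
- exact: cU.
Qed.

Lemma profileN U (A B : R) : profile U A B -> profile (fun x => - U x) (- A) (- B).
Proof.
move=> [f [g [D [N [M [[mf mg] bM E [N0 T] cU]]]]]].
exists g, f, D, N, M; split; [by split| | | |].
- by move=> x; have [] := bM x.
- by move=> x; rewrite E opprB.
- by split; [exact: N0|move=> x; have [h1 h2] := T x; split=> [/h1|/h2] ->].
- by move=> x xD; apply: cvgN; exact: cU.
Qed.

Lemma profileD U V (A B A' B' : R) : profile U A B -> profile V A' B' ->
  profile (fun x => U x + V x) (A + A') (B + B').
Proof.
move=> [f [g [D [N [M [[mf mg] bM E [N0 T] cU]]]]]].
move=> [f' [g' [D' [N' [M' [[mf' mg'] bM' E' [N0' T'] cU']]]]]].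
exists (fun x => f x + f' x), (fun x => g x + g' x), (D ++ D'), (N + N'), (M + M').
split.
- by split => x y xy; apply: lerD; [exact: mf|exact: mf'|exact: mg|exact: mg'].
- move=> x; have [h1 h2] := bM x; have [h1' h2'] := bM' x.
  by split; rewrite (le_trans (ler_normD _ _))// lerD.
- by move=> x; rewrite E E'; ring.
- split; first exact: addr_gt0.
  move=> x; have [h1 h2] := T x; have [h1' h2'] := T' x.
  by split => H; [rewrite h1 ?h1'|rewrite h2 ?h2'] => //; lra.
- move=> x; rewrite mem_cat negb_or => /andP[xD xD'].
  by apply: cvgD; [exact: cU|exact: cU'].
Qed.

Lemma profile_ext U V (A B : R) : (forall x, V x = U x) ->
  profile U A B -> profile V A B.
Proof. by move=> UV; have -> : V = U by exact/funext. Qed.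

Lemma profile_nonincreasing U (A B : R) (D : seq R) (N : R) :
  {homo U : x y / x <= y >-> y <= x} -> 0 < N ->
  (forall x, x <= - N -> U x = A) -> (forall x, N <= x -> U x = B) ->
  (forall x, x \notin D -> {for x, continuous U}) -> profile U A B.
Proof.
move=> mU N0 UA UB cU.
apply: (@profile_ext (fun x => - (- U x))); first by move=> x; rewrite opprK.
rewrite -[A]opprK -[B]opprK; apply: profileN.
apply: (@profile_homo _ _ _ D N _ N0).
- by move=> x y xy; rewrite lerN2; exact: mU.
- by move=> x /UA ->.
- by move=> x /UB ->.
- by move=> x xD; apply: cvgN; exact: cU.
Qed.

Lemma step_cts (s a b x : R) : x != s ->
  {for x, continuous (fun y => if y < s then a else b)}.
Proof.
rewrite neq_lt => /orP[xs|sx].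
  apply: (@near_cts _ (fun=> a)); last exact: cvg_cst.
  by near=> y; rewrite ifT//; near: y; exact: lt_nbhsl.
apply: (@near_cts _ (fun=> b)); last exact: cvg_cst.
by near=> y; rewrite ifF//; apply/negbTE; rewrite -leNgt ltW//; near: y; exact: lt_nbhsr.
Unshelve. all: end_near. Qed.

Lemma profile_step (s A B : R) : profile (fun x => if x < s then A else B) A B.
Proof.
have tail x : x <= - (`|s| + 1) -> x < s.
  by move=> h; have := ler_norm (- s); rewrite normrN; lra.
have tail' x : `|s| + 1 <= x -> (x < s) = false.
  by move=> h; apply/negbTE; rewrite -leNgt; have := ler_norm s; lra.
have cD x : x \notin [:: s] -> {for x, continuous (fun y => if y < s then A else B)}.
  by rewrite inE; exact: step_cts.
have N0 : 0 < `|s| + 1 by rewrite ltr_wpDl.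
have [AB|/ltW BA] := leP A B.
  apply: profile_homo N0 _ _ cD => [x y xy|x /tail ->|x /tail' ->]//.
  have [ys|sy] := ltP y s; first by rewrite (le_lt_trans xy ys).
  by case: ifP.
apply: profile_nonincreasing N0 _ _ cD => [x y xy|x /tail ->|x /tail' ->]//.
have [ys|sy] := ltP y s; first by rewrite (le_lt_trans xy ys).
by case: ifP.
Qed.

Lemma profile_mirror U (A B : R) : profile U A B ->
  profile (fun x => U (- x)) B A.
Proof.
move=> [f [g [D [N [M [[mf mg] bM E [N0 T] cU]]]]]].
exists (fun x => - g (- x)), (fun x => - f (- x)), [seq - d | d <- D], N, M.
split => //.
- by split => x y xy; rewrite lerN2; [apply: mg|apply: mf]; rewrite lerN2.
- by move=> x; rewrite !normrN; have [] := bM (- x).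
- by move=> x; rewrite E opprK addrC.
- split => // x; have [h1 h2] := T (- x).
  by split=> h; [apply: h2; rewrite lerNr|apply: h1; rewrite lerN2].
- move=> x xD; apply: (@continuous_comp _ _ _ (fun x : R => - x) U).
    by apply: cvgN; exact: cvg_id.
  by apply: cU; apply: contra xD => xD; apply/mapP; exists (- x); rewrite ?opprK.
Qed.

Lemma profile_step_le (s A B : R) : profile (fun x => if x <= s then A else B) A B.
Proof.
apply: profile_ext (profile_mirror (profile_step (- s) B A)) => x.
by rewrite ltrN2 ltNge; case: (x <= s).
Qed.

Lemma profile_measurable U (A B t : R) : 0 < t -> profile U A B ->
  measurable_fun setT (fun x : R => U (x / t)).
Proof.
move=> t0 [f [g [D [N [M [[mf mg] bM E _ _]]]]]].
have -> : (fun x => U (x / t)) = (fun x => f (x / t) - g (x / t)).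
  by apply/funext => x; rewrite E.
have mdiv (h : R -> R) : {homo h : x y / x <= y} ->
    measurable_fun setT (fun x : R => h (x / t)).
  move=> mh; apply: nondecreasing_measurable => // x y xy.
  by apply: mh; rewrite ler_pM2r// invr_gt0.
by apply: measurable_funB; exact: mdiv.
Qed.

Lemma profile_BV U (A B t : R) : 0 < t -> profile U A B ->
  BV_line (fun x => U (x / t)).
Proof.
move=> t0 [f [g [D [N [M [[mf mg] bM E _ _]]]]]].
exists (2 * M + 2 * M) => a b ab.
have -> : (fun x => U (x / t)) =
    (fun x => f (x / t)) \+ (\- (fun x => g (x / t))).
  by apply/funext => x; rewrite /= E.
have mdiv (h : R -> R) : {homo h : x y / x <= y} ->
    {in `[a, b] &, nondecreasing_fun (fun x : R => h (x / t))}.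
  by move=> mh x y _ _ xy; apply: mh; rewrite ler_pM2r// invr_gt0.
apply: (le_trans (total_variation_le _ _ ab)).
rewrite total_variationN !nondecreasing_total_variation//; [|exact: mdiv..].
rewrite -EFinD lee_fin.
have := bM (a / t); have := bM (b / t); rewrite !ler_norml.
by move=> [/andP[? ?] /andP[? ?]] [/andP[? ?] /andP[? ?]]; lra.
Qed.

Lemma profile_bounded U (A B : R) : profile U A B ->
  exists2 M, 0 <= M & forall x, `|U x| <= M.
Proof.
move=> [f [g [D [N [M [_ bM E _ _]]]]]].
have M0 : 0 <= M by have [h _] := bM 0; exact: le_trans h.
exists (M + M) => [|x]; first exact: addr_ge0.
by rewrite E (le_trans (ler_normB _ _))// lerD; have [? ?] := bM x.
Qed.

Lemma ae_off_seq (D : seq R) (P : R -> Prop) :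
  (forall x, x \notin D -> P x) -> {ae mu, forall x, P x}.
Proof.
move=> DP; apply: (@negligibleS _ _ _ mu [set` D]).
  move=> x /= nP; apply: contrapT => xD; apply: nP; apply: DP.
  by apply/negP => xD'; apply: xD.
have cD : countable [set` D] by exact/finite_set_countable/finite_seq.
apply/negligibleP; last exact: countable_lebesgue_measure0.
by apply: countable_measurable => // x; exact: measurable_set1.
Qed.

Definition self_similar U (A B t x : R) : R :=
  if 0 < t then U (x / t) else if x < 0 then A else B.

Lemma self_similar_measurable U A B t : profile U A B ->
  measurable_fun setT (self_similar U A B t).
Proof.
move=> pU; rewrite /self_similar.
have [t0|t0] := ltP 0 t; first exact: profile_measurable pU.
have := profile_measurable ltr01 (profile_step 0 A B).
by under eq_fun do rewrite divr1.
Qed.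

Lemma self_similar_bounded U A B : profile U A B ->
  exists2 M, 0 <= M & forall t x, `|self_similar U A B t x| <= M.
Proof.
move=> pU; have [M M0 MP] := profile_bounded pU.
exists (M + (`|A| + `|B|)) => [|t x]; first by rewrite !addr_ge0.
rewrite /self_similar; case: ifP => _.
  by rewrite (le_trans (MP _))// lerDl addr_ge0.
by case: ifP => _; rewrite ler_wpDl// ?lerDl ?lerDr.
Qed.

Lemma self_similar_locally_integrable U A B t : profile U A B ->
  locally_integrable setT (self_similar U A B t).
Proof.
move=> pU; have mS := self_similar_measurable t pU.
have [M M0 MP] := self_similar_bounded pU.
split; [exact: mS|exact: openT|] => K _ cK.
apply: (@le_lt_trans _ _ (\int[mu]_(x in K) (cst M%:E x))%E).
  apply: ge0_le_integral => //.
  - exact: compact_measurable.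
  - apply/measurable_EFinP; apply: measurableT_comp => //.
    by apply: measurable_funTS; exact: mS.
  - by move=> x _; rewrite lee_fin.
rewrite integral_cst//; last exact: compact_measurable.
by apply: lte_mul_pinfty => //; exact: compact_finite_measure.
Qed.

(* t is replaced by its absolute value to work with the full neighbourhoods
   of t0 = 0. *)
Lemma self_similar_cts U A B (t0 : R) : profile U A B -> 0 <= t0 ->
  {ae mu, forall x, {for t0, continuous (fun t : R => self_similar U A B `|t| x)}}.
Proof.
move=> [f [g [D [N [M [_ _ _ [N0 T] cU]]]]]] t00.
(* The excluded points are the origin and the positions at time [t0] of the discontinuities. For
   [t0 = 0] the origin is enough: elsewhere [x / t] enters a constant tail. *)
apply: (@ae_off_seq (0 :: [seq t0 * d | d <- D])) => x.
rewrite inE negb_or => /andP[x0 xD].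
move: t00; rewrite le_eqVlt => /predU1P[<-|t00].
  apply: (@near_cts _ (fun=> if x < 0 then A else B)); last exact: cvg_cst.
  near=> t; rewrite /self_similar; case: ifP => // tp.
  have tN : `|t| <= `|x| / N.
    by near: t; apply: (@nbhs0_le R R^o); rewrite divr_gt0// normr_gt0.
  have [h1 h2] := T (x / `|t|).
  have := x0; rewrite neq_lt => /orP[xn|xp].
    rewrite xn h1// ler_pdivrMr// mulNr lerNr -ltr0_norm//.
    by rewrite mulrC -ler_pdivlMr.
  rewrite ltNge (ltW xp) /= h2// ler_pdivlMr// mulrC -ler_pdivlMr//.
  by move: tN; rewrite [`|x|]gtr0_norm.
apply: (@near_cts _ (fun t : R => U (x / t))).
  near=> t; have tp : 0 < t by near: t; exact: lt_nbhsr.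
  by rewrite /self_similar gtr0_norm// tp.
apply: (@continuous_comp _ _ _ (fun t : R => x / t) U).
  apply: cvgM; first exact: cvg_cst.
  by apply: cvgV; [rewrite gt_eqF|exact: cvg_id].
apply: cU; apply: contra xD => xD; apply/mapP; exists (x / t0) => //.
by rewrite mulrC divfK// gt_eqF.
Unshelve. all: end_near. Qed.

(** Profiles are uniformly bounded and converge almost everywhere, so dominated convergence along
    sequences gives continuity in the local [L^1] distance. *)
Lemma self_similar_C0 U1 U2 A1 A2 B1 B2 :
  profile U1 A1 B1 -> profile U2 A2 B2 ->
  (forall t x, 0 < self_similar U1 A1 B1 t x) ->
  C0_L1loc (fun t x =>
    (self_similar U1 A1 B1 t x, self_similar U2 A2 B2 t x)).
Proof.
move=> p1 p2 pos; split.
  move=> t _; split => /=; [exact: self_similar_locally_integrable..|].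
  by apply/aeW => x; exact: pos.
move=> t0 a b t00 /=.
set s1 := self_similar U1 A1 B1; set s2 := self_similar U2 A2 B2.
pose h t x := `|s1 t x - s1 t0 x| + `|s2 t x - s2 t0 x|.
have [M1 M10 M1P] := self_similar_bounded p1.
have [M2 M20 M2P] := self_similar_bounded p2.
have mh t : measurable_fun `[a, b] (fun x => h t x).
  apply: measurable_funTS; apply: measurable_funD; apply: measurableT_comp => //;
    by apply: measurable_funB; exact: self_similar_measurable.
have hM t x : `|h t x| <= (M1 + M1) + (M2 + M2).
  rewrite ger0_norm ?addr_ge0//; apply: lerD.
    by apply: le_trans (ler_normB _ _) _; apply: lerD; exact: M1P.
  by apply: le_trans (ler_normB _ _) _; apply: lerD; exact: M2P.
have ic (k : R) : mu.-integrable `[a, b] (fun=> k%:E).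
  by apply: integrable_itvcc; apply: continuous_subspaceT => x; exact: cvg_cst.
have ih t : mu.-integrable `[a, b] (fun x => (h t x)%:E).
  apply: (@le_integrable _ _ _ mu _ (measurable_itv _) _
    (fun=> ((M1 + M1) + (M2 + M2))%:E)) => //.
    by apply/measurable_EFinP; exact: mh.
  move=> x _ /=; rewrite lee_fin (le_trans (hM t x))//.
  exact: ler_norm.
pose G (t : R) := fine (\int[mu]_(x in `[a, b]) (h `|t| x)%:E)%E.
have G0 : G t @[t --> t0] --> 0.
  apply/(@cvg_nbhsP _ R^o) => u ut0.
  have cv : {ae mu, forall x, `[a, b]%classic x ->
      (fun n => (h `|u n| x)%:E) @ \oo --> (fun=> 0%E : \bar R) x}.
    have c1 := self_similar_cts p1 t00; have c2 := self_similar_cts p2 t00.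
    apply: ae_imply2 c1 c2 => x c1 c2 _.
    have sc (s : R -> R -> R) : {for t0, continuous (fun t => s `|t| x)} ->
        `|s `|u n| x - s t0 x| @[n --> \oo] --> 0.
      move=> cs; rewrite -[X in _ --> X](normr0 R); apply: cvg_norm.
      rewrite -[X in _ --> X](subrr (s t0 x)); apply: cvgB; last exact: cvg_cst.
      have <- : s `|t0| x = s t0 x by rewrite ger0_norm.
      exact: (cvg_comp _ _ ut0 cs).
    apply: cvg_EFin; first by apply: nearW.
    rewrite -[X in _ --> X](addr0 (0 : R)).
    by apply: cvgD; [exact: sc c1|exact: sc c2].
  have dom : {ae mu, forall x n, `[a, b]%classic x ->
      (`|(h `|u n| x)%:E| <= (fun=> ((M1 + M1) + (M2 + M2))%:E) x)%E}.
    by apply/aeW => x n _; rewrite lee_fin.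
  have mf n : measurable_fun `[a, b] (fun x => (h `|u n| x)%:E).
    by apply/measurable_EFinP; exact: mh.
  have [_ _ L] := @dominated_convergence _ _ _ mu _ (measurable_itv _)
    (fun n x => (h `|u n| x)%:E) (fun=> 0%E) _ mf (measurable_cst _) cv (ic _) dom.
  rewrite integral0 in L; exact: (fine_cvg L).
apply: (@cvg_trans _ (EFin \o G @ within [set t | 0 <= t] (nbhs t0))).
  apply: near_eq_cvg; rewrite near_withinE; near=> t => t_ge0 /=.
  rewrite /G ger0_norm// fineK//; exact: integrable_fin_num.
apply: cvg_within_filter; apply: cvg_EFin; first by apply: nearW.
exact: G0.
Unshelve. all: end_near. Qed.

End Profiles.

(** * Shocks and rarefaction fans as transitions between constant states *)

Section Fan.
Variable R : realType.
Implicit Types W f : R -> R.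

(* Inside a rarefaction fan both equations read (f - xi W)' = - W. *)
Definition fan W f (a b : R) : Prop :=
  [/\ {within `[a, b], continuous W}, {within `[a, b], continuous f} &
      forall xi, a < xi < b ->
        is_derive xi 1 (fun xi => f xi - xi * W xi) (- W xi)].

(* The sector [a, b] is a shock when a = b and a fan otherwise. *)
Definition transition W f (wa fa wb fb a b : R) : Prop :=
  [/\ forall xi, xi < a -> W xi = wa /\ f xi = fa,
      forall xi, b < xi -> W xi = wb /\ f xi = fb &
      (a = b /\ fa - a * wa = fb - b * wb) \/
      [/\ a < b, fan W f a b, W a = wa /\ f a = fa & W b = wb /\ f b = fb]].

Lemma transition_sector (phi : R * R -> R) W f (wa fa wb fb a b c d : R) :
  test_function phi -> transition W f wa fa wb fb a b -> c <= a -> b <= d ->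
  sector phi W f c d (fa - c * wa) (fb - d * wb).
Proof.
move=> tphi [Wa Wb ab] ca bd.
have S1 : sector phi W f c a (fa - c * wa) (fa - a * wa).
  by apply: sector_const => // xi /andP[_]; exact: Wa.
have S3 : sector phi W f b d (fb - b * wb) (fb - d * wb).
  by apply: sector_const => // xi /andP[+ _]; exact: Wb.
case: ab => [[ab E]|[ab [cW cf dG] [Ea fEa] [Eb fEb]]].
  move: bd S3; rewrite -E -ab => bd S3.
  exact: (@sector_glue _ _ _ _ c a d _ _ _ ca bd S1 S3).
have S2 : sector phi W f a b (fa - a * wa) (fb - b * wb).
  by rewrite -fEa -{1}Ea -fEb -{1}Eb; exact: sector_smooth.
apply: (@sector_glue _ _ _ _ c a d _ _ _ ca (le_trans (ltW ab) bd) S1).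
exact: (@sector_glue _ _ _ _ a b d _ _ _ (ltW ab) bd S2 S3).
Qed.

Lemma within_opp f (a b : R) : {within `[a, b], continuous f} ->
  {within `[- b, - a], continuous (fun x => f (- x))}.
Proof.
move=> cf; apply: within_comp cf => [x|].
  by rewrite /= !in_itv/= => /andP[h1 h2]; rewrite lerNr h2 lerNl h1.
by apply: continuous_subspaceT => x; apply: cvgN; exact: cvg_id.
Qed.

(** Under the reflection density and flow are even, momentum is odd. Thus [e = 1] transports the
    equation for mass and [e = - 1] the one for momentum. *)
Lemma transition_mirror W f (wa fa wb fb a b e : R) :
  transition W f wa fa wb fb a b ->
  transition (fun xi => e * W (- xi)) (fun xi => - e * f (- xi))
    (e * wb) (- e * fb) (e * wa) (- e * fa) (- b) (- a).
Proof.
move=> [Wa Wb ab]; split.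
- by move=> xi h; have [|-> ->//] := Wb (- xi); rewrite ltrNr.
- by move=> xi h; have [|-> ->//] := Wa (- xi); rewrite ltrNl.
case: ab => [[ab E]|[ab [cW cf dG] [Ea fEa] [Eb fEb]]]; [left|right].
  split; first by rewrite ab.
  have -> : - e * fb - - b * (e * wb) = - e * (fb - b * wb) by ring.
  by rewrite -E; ring.
rewrite ltrN2 !opprK Ea Eb fEa fEb; split; [exact: ab| |by []|by []].
have cW' := within_opp cW; have cf' := within_opp cf.
split.
- by move=> x; apply: cvgM; [exact: cvg_cst|exact: cW'].
- by move=> x; apply: cvgM; [exact: cvg_cst|exact: cf'].
- move=> xi /andP[h1 h2].
  have d1 : is_derive xi 1 (fun x : R => - x) (-1).
    by apply: is_derive_eq.
  have xab : a < - xi < b by rewrite ltrNr h2 ltrNl h1.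
  have := @is_derive1_comp _ _ (fun x => - x) xi _ _ (dG _ xab) d1.
  move=> d2.
  have d3 := is_deriveZ (- e) d2.
  have -> : (fun x => - e * f (- x) - x * (e * W (- x))) =
     (- e) *: ((fun x => f x - x * W x) \o (fun x => - x)).
    by apply/funext => x; rewrite !fctE /GRing.scale/=; ring.
  apply: (@is_derive_eq _ _ _ _ _ _ _ _ d3).
  by rewrite /GRing.scale/=; ring.
Qed.

Variables (sigma : R -> R) (rm ro : R).
Hypothesis rmro : rm < ro.
Hypothesis csigma : {within `[rm, ro], continuous sigma}.
Hypothesis dsigma : forall r s, rm <= r -> r < s -> s <= ro ->
  sigma s < sigma r.
Local Notation alpha := (sigma ro).
Local Notation beta := (sigma rm).

Lemma fan_exists : exists rho : R -> R,
  [/\ continuous rho, {homo rho : x y / x <= y >-> y <= x},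
      forall xi, rm <= rho xi <= ro,
      (forall xi, xi <= alpha -> rho xi = ro) /\
      (forall xi, beta <= xi -> rho xi = rm) &
      forall xi, alpha <= xi <= beta -> sigma (rho xi) = xi].
Proof.
have ab : alpha < beta by apply: dsigma.
pose g y := xget rm [set r | rm <= r <= ro /\ sigma r = y].
have gP y : alpha <= y <= beta -> rm <= g y <= ro /\ sigma (g y) = y.
  move=> /andP[h1 h2]; have [|r] := @IVT R sigma rm ro y (ltW rmro) csigma.
    by rewrite ge_min h1 orbT le_max h2.
  rewrite in_itv/= => rr E; rewrite /g.
  exact: (@xgetPex _ rm [set r | rm <= r <= ro /\ sigma r = y] (ex_intro _ r (conj rr E))).
have sinj r s : rm <= r <= ro -> rm <= s <= ro -> sigma r = sigma s -> r = s.
  move=> /andP[h1 h2] /andP[h3 h4] E; have [rs|sr|//] := ltgtP r s.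
    by have := dsigma h1 rs h4; rewrite E ltxx.
  by have := dsigma h3 sr h2; rewrite E ltxx.
have sran r : rm <= r <= ro -> alpha <= sigma r <= beta.
  move=> /andP[h1 h2]; apply/andP; split.
    by move: h2; rewrite le_eqVlt => /predU1P[->//|h2]; rewrite ltW// dsigma.
  by move: h1; rewrite le_eqVlt => /predU1P[->//|h1]; rewrite ltW// dsigma.
have gK : {in `[rm, ro], cancel sigma g}.
  move=> r; rewrite in_itv/= => rr; have [h1 h2] := gP _ (sran _ rr).
  exact: sinj.
have cg : {within `[alpha, beta], continuous g}.
  exact: segment_can_ge_continuous (ltW rmro) csigma gK.
(* Clipping to [[alpha, beta]] extends the inverse of [sigma] continuously by its end values, which
   are the constant states on either side of the fan. *)
pose clip xi := Order.min beta (Order.max alpha xi).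
have clipab xi : alpha <= clip xi <= beta.
  by rewrite le_min (ltW ab) le_max lexx /= ge_min lexx.
have cclip : continuous clip.
  move=> x; apply: continuous_min; first exact: cvg_cst.
  by apply: continuous_max; [exact: cvg_cst|exact: cvg_id].
exists (g \o clip); split.
- have : {within setT, continuous (g \o clip)}.
    apply: within_comp cg; last exact: continuous_subspaceT.
    by move=> x _; rewrite /= in_itv/=.
  move=> /subspace_continuousP H x P /(H x I).
  by rewrite /within/= !nbhs_simpl/=; apply: filterS => y; exact.
- move=> x y xy; have [/andP[h1 h2] E1] := gP _ (clipab x).
  have [/andP[h3 h4] E2] := gP _ (clipab y).
  rewrite /= leNgt; apply/negP => lt.
  have := dsigma h1 lt h4; rewrite E1 E2 ltNge => /negP; apply.
  by rewrite /clip le_min2// le_max2.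
- by move=> xi; have [] := gP _ (clipab xi).
- split=> xi h.
    have E : clip xi = alpha by rewrite /clip (max_idPl h) (min_idPr (ltW ab)).
    by rewrite /= E gK// in_itv/= lexx ltW.
  have E : clip xi = beta.
    by rewrite /clip (max_idPr (le_trans (ltW ab) h)) (min_idPl h).
  by rewrite /= E gK// in_itv/= lexx ltW.
- move=> xi /andP[h1 h2]; have E : clip xi = xi.
    by rewrite /clip (max_idPr h1) (min_idPr h2).
  by rewrite /= E; have [] := gP xi; rewrite ?h1.
Qed.

Variable rho : R -> R.
Hypothesis crho : continuous rho.
Hypothesis rho_in : forall xi, rm <= rho xi <= ro.
Hypothesis rhoK : forall xi, alpha <= xi <= beta -> sigma (rho xi) = xi.
Hypothesis rho_left : forall xi, xi <= alpha -> rho xi = ro.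
Hypothesis rho_right : forall xi, beta <= xi -> rho xi = rm.
Variables (B b F : R -> R).
Hypothesis cB : {within `[rm, ro], continuous B}.
Hypothesis cF : {within `[rm, ro], continuous F}.
Hypothesis dB : forall r, rm < r < ro -> is_derive r 1 B (b r).
Hypothesis dF : forall r, rm < r < ro -> is_derive r 1 F (sigma r * b r).
Hypothesis b0 : forall r, rm < r < ro -> b r != 0.

(** Cauchy's mean value theorem on the density interval: the derivatives of [F] and [B] have ratio
    [sigma], and [sigma] takes there only values between [x] and [y], because it is decreasing and
    inverts [rho]. *)
Let fan_quotient (x y : R) : alpha <= x -> x < y -> y <= beta ->
  exists2 z, x <= z <= y &
    F (rho y) - F (rho x) = z * (B (rho y) - B (rho x)).
Proof.
move=> ax xy yb.
have /andP[x1 x2] := rho_in x; have /andP[y1 y2] := rho_in y.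
have sx : sigma (rho x) = x by rewrite rhoK// ax (le_trans (ltW xy)).
have sy : sigma (rho y) = y by rewrite rhoK// yb (le_trans ax)// ltW.
have lt : rho y < rho x.
  rewrite ltNge; apply/negP; rewrite le_eqVlt => /predU1P[E|lt].
    by move: xy; rewrite -sx -sy E ltxx.
  by have := dsigma x1 lt y2; rewrite sx sy ltNge (ltW xy).
have sub : `[rho y, rho x] `<=` `[rm, ro].
  by move=> r; rewrite /= !in_itv/= => /andP[h1 h2]; rewrite (le_trans y1)// (le_trans h2).
have inn r : r \in `]rho y, rho x[ -> rm < r < ro.
  by rewrite in_itv/= => /andP[h1 h2]; rewrite (le_lt_trans y1)// (lt_le_trans h2).
have dB' r : r \in `]rho y, rho x[ -> is_derive r 1 B (b r) by move/inn; exact: dB.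
have dF' r : r \in `]rho y, rho x[ -> is_derive r 1 F (sigma r * b r) by move/inn; exact: dF.
have b0' r : r \in `]rho y, rho x[ -> b r != 0 by move/inn; exact: b0.
have cB' := continuous_subspaceW sub cB; have cF' := continuous_subspaceW sub cF.
have nz := differentiable_subr_neq0 lt cB' dB' b0'.
have [r rin E] := cauchy_MVT lt cF' cB' dF' dB' b0'.
exists (sigma r).
  move: rin; rewrite in_itv/= => /andP[h1 h2].
  rewrite -{1}sx -sy ltW ?dsigma ?(le_trans y1 (ltW h1))//=.
  by rewrite ltW// dsigma// (le_trans (ltW h2)).
rewrite mulfK in E; last exact: b0'.
by rewrite -opprB -[B _ - _]opprB mulrN E divfK.
Qed.

Lemma fan_transition : transition (B \o rho) (F \o rho)
  (B ro) (F ro) (B rm) (F rm) alpha beta.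
Proof.
have ab : alpha < beta by apply: dsigma.
have rhoa := rho_left (lexx alpha); have rhob := rho_right (lexx beta).
have crho' : {within `[alpha, beta], continuous rho} by exact: continuous_subspaceT.
have rho_in' x : `[alpha, beta]%classic x -> `[rm, ro]%classic (rho x).
  by move=> _; rewrite /= in_itv/=.
have cW := within_comp rho_in' crho' cB.
have cf := within_comp rho_in' crho' cF.
split.
- by move=> xi /ltW/rho_left E; rewrite /= E.
- by move=> xi /ltW/rho_right E; rewrite /= E.
right; split; rewrite /= ?rhoa ?rhob//.
split => // xi /andP[ax xb]; apply/is_derive1P; apply/cvgrPdist_le => e e0.
have cBx : {for xi, continuous (B \o rho)}.
  have [+ _ _] := (continuous_within_itvP _ ab).1 cW.
  by apply; rewrite in_itv/= ax.
have H1 : \forall h \near (0 : R)^', h != 0 by exact: nbhs_dnbhs_neq.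
have [d d0 dP] : exists2 d : R, 0 < d & forall h, `|h| < d ->
    [/\ alpha <= xi + h, xi + h <= beta &
       `|B (rho xi) - B (rho (xi + h))| <= e].
  have /cvgrPdist_le/(_ e e0)/nbhs_ballP[d /= d0 dP] := cBx.
  exists (Order.min d (Order.min (xi - alpha) (beta - xi))).
    by rewrite !lt_min d0 !subr_gt0 ax.
  move=> h; rewrite !lt_min => /and3P[h1 h2 h3]; split.
  - by have := ler_norm (- h); rewrite normrN; lra.
  - by have := ler_norm h; lra.
  - by apply: dP; rewrite /ball/= opprD addNKr normrN.
have H2 : \forall h \near (0 : R)^', `|h| < d by exact: dnbhs0_lt.
near=> h.
have h0 : h != 0 by near: h.
have [h1 h2 hB] : [/\ alpha <= xi + h, xi + h <= beta &
    `|B (rho xi) - B (rho (xi + h))| <= e] by apply: dP; near: h.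
have [z zh Ez] : exists2 z, `|z - (xi + h)| <= `|h| &
    F (rho (xi + h)) - F (rho xi) = z * (B (rho (xi + h)) - B (rho xi)).
  have [hn|hp|h00] := ltgtP h 0; last by move: h0; rewrite h00 eqxx.
    have [|z /andP[z1 z2] E] := @fan_quotient (xi + h) xi h1 _ (ltW xb).
      by rewrite gtrDl.
    exists z; last by rewrite -opprB E; ring.
    by rewrite ger0_norm ?subr_ge0// ltr0_norm//; lra.
  have [|z /andP[z1 z2] E] := @fan_quotient xi (xi + h) (ltW ax) _ h2.
    by rewrite ltrDl.
  exists z => //.
  by rewrite ler0_norm ?subr_le0// gtr0_norm//; lra.
(* The error of the difference quotient of [G] is a factor of modulus at most 1, since [z] lies
   between [xi] and [xi + h], times an increment of [B \o rho], which is small by continuity. *)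
have -> : - B (rho xi) - h^-1 * (F (rho (xi + h)) - (xi + h) * B (rho (xi + h))
      - (F (rho xi) - xi * B (rho xi))) =
    (z - (xi + h)) / h * (B (rho xi) - B (rho (xi + h))).
  have -> : F (rho (xi + h)) = F (rho xi) + z * (B (rho (xi + h)) - B (rho xi)).
    by rewrite -Ez; ring.
  by field.
rewrite normrM; apply: le_trans hB; rewrite ler_piMl//.
by rewrite normrM normfV ler_pdivrMr ?mul1r// normr_gt0.
Unshelve. all: end_near. Qed.

End Fan.

(** * Lax waves: uniqueness and construction *)

Section Waves.
Variable R : realType.
Variable p : R -> R.
Hypothesis pp : pressure p.
Local Notation state := (R * R)%type.

(* [lax_wave1] with the value at the shock left to the parameter cl, so that
   the second family is the mirror image of the first. *)
Definition wave1 (cl : bool) (ul um : state) (w : R -> state) : Prop :=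
  [/\ 0 < um.1, um.2 = L1 p um.1 ul &
    if ul.1 < um.1 then
      let s := (um.2 - ul.2) / (um.1 - ul.1) in
      forall xi, w xi = if (if cl then xi <= s else xi < s) then ul else um
    else
      forall xi,
        [/\ xi <= lambda1 p ul -> w xi = ul,
            lambda1 p um <= xi -> w xi = um &
            lambda1 p ul <= xi <= lambda1 p um ->
              [/\ um.1 <= (w xi).1 <= ul.1, (w xi).2 = L1 p (w xi).1 ul &
                  lambda1 p (w xi) = xi]]].

Lemma wave2_mirror (um ur : state) (w : R -> state) :
  lax_wave2 p um ur w <->
  wave1 true (mirror ur) (mirror um) (fun xi => mirror (w (- xi))).
Proof.
have mI u v : mirror u = mirror v <-> u = v :> state.
  by split=> [/(congr1 (@mirror R))|->//]; rewrite !mirrorK.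
have E2 u v : u.2 = L2rev p u.1 v <-> (mirror u).2 = L1 p u.1 (mirror v) :> R.
  rewrite L2rev_mirror /=; split=> [->|<-]; by rewrite opprK.
have Es : ((mirror um).2 - (mirror ur).2) / ((mirror um).1 - (mirror ur).1) =
    - ((ur.2 - um.2) / (ur.1 - um.1)).
  rewrite /= -[um.1 - _]opprB invrN mulrN; congr (- (_ * _)); ring.
split=> [[m0 m2 H]|[m0 m2 H]]; split => //.
- exact/E2.
- move: H; rewrite /=; case: ifP => _ H xi.
    by rewrite H Es ltrNl ltNge; case: (xi <= _).
  have [h1 h2 h3] := H (- xi).
  rewrite !lambda1_mirror.
  split.
  + by rewrite lerNr => /h2 ->.
  + by rewrite lerNl => /h1 ->.
  + rewrite lerNr lerNl andbC => /h3[e1 e2 e3]; split; first exact: e1.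
      exact/E2.
    by rewrite e3 opprK.
- exact/E2.
- move: H; rewrite /=; case: ifP => _ H xi.
    have := H (- xi); rewrite opprK Es => E; apply/mI; rewrite E lerN2 leNgt.
    by case: (xi < _).
  have := H (- xi); rewrite opprK !lambda1_mirror => -[h1 h2 h3].
  split.
  + by move=> h; apply/mI/h2; rewrite lerN2.
  + by move=> h; apply/mI/h1; rewrite lerN2.
  + rewrite !lerN2 andbC in h3; move=> /h3[e1 e2 e3]; split => //.
      exact/E2.
    exact: oppr_inj.
Qed.

(** In the fan the state lies on the 1-curve with a prescribed [lambda1], which is injective along
    that curve. *)
Lemma wave1_uniq cl (ul um : state) (w w' : R -> state) : 0 < ul.1 ->
  wave1 cl ul um w -> wave1 cl ul um w' -> w =1 w'.
Proof.
move=> ul0 [m0 m2 H] [_ _ H'] xi; move: H H'; case: ifP => [_ H H'|nlt H H'].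
  by rewrite H H'.
have [h1 h2 h3] := H xi; have [h1' h2' h3'] := H' xi.
have [a|a] := leP xi (lambda1 p ul); first by rewrite h1// h1'.
have [b|b] := leP (lambda1 p um) xi; first by rewrite h2// h2'.
have ab : lambda1 p ul <= xi <= lambda1 p um by rewrite !ltW.
have [/andP[r1 _] q e] := h3 ab; have [/andP[r1' _] q' e'] := h3' ab.
have r0 := lt_le_trans m0 r1; have r0' := lt_le_trans m0 r1'.
have lt (x y : R) : 0 < x -> x < y -> lambda1 p (y, L1 p y ul) < lambda1 p (x, L1 p x ul).
  by clear -pp ul0; case: ul ul0 => ro qo /= ul0; exact: lambda1_L1_lt.
move: q e q' e' r0 r0'; case: (w xi) => r1w q1w; case: (w' xi) => r2w q2w /=.
move=> -> e -> e' r0 r0'.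
have [l|l|->//] := ltgtP r1w r2w.
  by have := lt _ _ r0 l; rewrite e e' ltxx.
by have := lt _ _ r0' l; rewrite e e' ltxx.
Qed.

Variables (hat check : R * R -> R).
Hypothesis sonic : sonic_L1 p hat check.

(** Shock, trivial wave or rarefaction, by comparing [rm] with the density of [ul]. The wave stays
    in [xi <= 0]: momentum decreases along the subsonic branch, so a shock has negative speed, and a
    fan ends at [lambda1 um <= 0]. If [um] is sonic the fan reaches [xi = 0], and continuity there
    still makes [um] the trace. *)
Lemma wave1_exists cl (ul um : state) (rm : R) : A0 p ul ->
  hat ul <= rm <= check ul -> um = (rm, L1 p rm ul) ->
  exists w : R -> state, exists a b : R,
  [/\ wave1 cl ul um w, b <= 0,
      transition (fst \o w) (snd \o w) ul.1 ul.2 um.1 um.2 a b /\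
      transition (snd \o w) (flow p \o w) ul.2 (flow p ul) um.2 (flow p um) a b,
      profile (fst \o w) ul.1 um.1 /\ profile (snd \o w) ul.2 um.2 &
      [/\ forall xi, A0_closed p (w xi), forall xi, 0 <= xi -> w xi = um,
          {for 0, continuous (fst \o w)} & {for 0, continuous (snd \o w)}]].
Proof.
move=> Au hrk {um}->; set um := (rm, L1 p rm ul).
have [h0 hu uk _ _] := branch_ends pp sonic Au.
have Bc := branch_closed pp sonic Au.
have Blt := branch_lt pp sonic Au.
have /andP[hr rk] := hrk; have rm0 := lt_le_trans h0 hr.
have Aum : A0_closed p um by apply/Bc.
have Aul : A0_closed p ul by exact: A0_closedW.
have N0 : forall a b : R, exists2 N, 0 < N & - N <= a /\ b <= N.
  move=> a b; exists (`|a| + `|b| + 1); first by rewrite ltr_wpDl// addr_ge0.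
  have := ler_norm (- a); have := ler_norm b; rewrite normrN.
  by have := normr_ge0 a; have := normr_ge0 b => ? ? ? ?; split; lra.
have [rou|ru] := ltP ul.1 rm.
  pose s := (um.2 - ul.2) / (um.1 - ul.1).
  have d0 : 0 < rm - ul.1 by rewrite subr_gt0.
  have [s0 Es] : s < 0 /\ um.2 - ul.2 = s * (rm - ul.1).
    split; last by rewrite divfK// gt_eqF.
    rewrite pmulr_llt0 ?invr_gt0// subr_lt0.
    have := (Blt _ _ (ltW hu) rou).1; rewrite /um /=.
    by case: (ul) Au => ro qo [/= ro0 _ _]; rewrite L1_start.
  have Ef : flow p um - flow p ul = s * (um.2 - ul.2).
    rewrite Es /um /s.
    move: rou d0 Es; rewrite /s /um; clear -pp Au.
    case: ul Au => ro qo [/= ro0 _ _] rou d0 _.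
    rewrite (flow_shockE pp qo ro0 rou) (L1_shockE p qo ro0 rou).
    by rewrite [qo + _]addrC !addrK mulfK ?gt_eqF//; ring.
  pose w xi := if (if cl then xi <= s else xi < s) then ul else um.
  have wl xi : xi < s -> w xi = ul.
    by move=> h; rewrite /w h ltW//; case: (cl).
  have wr xi : s < xi -> w xi = um.
    by move=> h; rewrite /w leNgt h /= ltNge (ltW h) /=; case: (cl).
  exists w, s, s; split.
  - by split => //=; rewrite rou.
  - exact: ltW.
  - split; (split; [by move=> xi /wl E; rewrite /= E|
      by move=> xi /wr E; rewrite /= E|left; split => //]).
      by move: Es; rewrite /um /= mulrBr; lra.
    by move: Ef; rewrite mulrBr; lra.
  - have pw (h : state -> R) : profile (h \o w) (h ul) (h um).
      rewrite /w; case: (cl).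
        by apply: profile_ext (profile_step_le s _ _) => xi /=; case: ifP.
      by apply: profile_ext (profile_step s _ _) => xi /=; case: ifP.
    by split; exact: pw.
  - have c0 (h : state -> R) : {for 0, continuous (h \o w)}.
      apply: (@near_cts _ (fun=> h um)); last exact: cvg_cst.
      by near=> xi; rewrite /= wr//; near: xi; exact: lt_nbhsr.
    split; [|by move=> xi xi0; rewrite wr// (lt_le_trans s0)|exact: c0|exact: c0].
    by move=> xi; rewrite /w; case: ifP.
have ul2 : L1 p ul.1 ul = ul.2.
  by case: (ul) Au => ro qo [/= ro0 _ _]; rewrite L1_start.
have ulE : (ul.1, L1 p ul.1 ul) = ul by rewrite ul2 -surjective_pairing.
move: ru; rewrite le_eqVlt => /predU1P[rmE|rmu].
  have umE : um = ul by rewrite /um rmE ulE.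
  (* A wave without a jump can be located anywhere in [xi <= 0]. *)
  rewrite umE; exists (fun=> ul), (-1), (-1); split.
  - split; [by case: Au|by rewrite ul2|rewrite ltxx => xi; split; [by []|by []|]].
    move=> /andP[h1 h2]; rewrite lexx ul2; split; [by []|by []|].
    by apply/eqP; rewrite eq_le h1 h2.
  - by rewrite lerN10.
  - by split; (split; [by []|by []|by left]).
  - by split; apply: (profile_ext _ (profile_step 0 _ _)) => x /=; case: ifP.
  - by split; [by []|by []|exact: cvg_cst|exact: cvg_cst].
pose sigma r := lambda1 p (r, L1 p r ul).
have sig (x : R) : 0 < x -> {for x, continuous sigma} /\ forall y, x < y -> sigma y < sigma x.
  rewrite /sigma; clear -pp Au; case: ul Au => ro qo [/= ro0 _ _] x0; split.
    exact: lambda1_L1_cts.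
  by move=> y; exact: lambda1_L1_lt.
have csigma : {within `[rm, ul.1], continuous sigma}.
  by apply: within_itvcc => x /andP[+ _] => /(lt_le_trans rm0)/sig[].
have dsigma r t : rm <= r -> r < t -> t <= ul.1 -> sigma t < sigma r.
  by move=> /(lt_le_trans rm0)/sig[_ H] /H.
have [rho [crho mrho rho_in [rho_l rho_r] rhoK]] := fan_exists rmu csigma dsigma.
pose L r := L1 p r ul.
have cL : {within `[rm, ul.1], continuous L}.
  by apply: within_itvcc => x /andP[+ _] => /(lt_le_trans rm0)/(branch_cts pp Au)[].
have cf : {within `[rm, ul.1], continuous (fun r => flow p (r, L r))}.
  by apply: within_itvcc => x /andP[+ _] => /(lt_le_trans rm0)/(branch_cts pp Au)[].
have der (r : R) : rm < r < ul.1 -> is_derive r 1 L (sigma r) /\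
    is_derive r 1 (fun r => flow p (r, L r)) (sigma r * sigma r).
  move=> /andP[/(lt_trans rm0) r0 ru]; rewrite /L /sigma.
  move: ru; clear -pp Au r0; case: ul Au => ro qo [/= ro0 _ _] ru.
  by split; [exact: L1_derive|rewrite -expr2; exact: flow_L1_derive].
have sm0 : sigma rm <= 0 by case: Aum.
have cid' : {within `[rm, ul.1], continuous (@id R)}.
  by apply: continuous_subspaceT => x; exact: cvg_id.
(* For mass the pair [(B, F)] is density and momentum, with derivatives [1] and [sigma]; for
   momentum it is momentum and flow, with derivatives [sigma] and [sigma^2]. In the second case [B']
   does not vanish, because [sigma] is strictly below its nonpositive value at [rm]. *)
have T1 := @fan_transition _ sigma rm ul.1 rmu dsigma rho crho rho_in rhoK
  rho_l rho_r id (fun=> 1) L cid' cL.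
have T2 := @fan_transition _ sigma rm ul.1 rmu dsigma rho crho rho_in rhoK
  rho_l rho_r L sigma (fun r => flow p (r, L r)) cL cf.
have rho0 xi : 0 < rho xi by have /andP[+ _] := rho_in xi; exact: lt_le_trans.
have cLr xi : {for xi, continuous (L \o rho)}.
  apply: continuous_comp; first exact: crho.
  by have [] := branch_cts pp Au (rho0 xi).
have [N N1 [N2 N3]] := N0 (sigma ul.1) (sigma rm).
exists (fun xi => (rho xi, L (rho xi))), (sigma ul.1), (sigma rm).
have s_ul : sigma ul.1 = lambda1 p ul by rewrite /sigma ulE.
split; [|exact: sm0| | |].
- split => //=; rewrite ltNge (ltW rmu) /= => xi; split.
  + by rewrite -s_ul => /rho_l ->; rewrite /L ulE.
  + by move/rho_r => ->.
  + by rewrite -s_ul => h; split => //; exact: rhoK.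
- split.
    have := T1; rewrite /L ul2; apply => r rr.
    + by rewrite mulr1; have [] := der r rr.
    + exact: oner_neq0.
  have := T2; rewrite /L ulE ul2; apply => r rr.
  + by have [] := der r rr.
  + by have [] := der r rr.
  + have /andP[r1 _] := rr; have [_ sr] := sig _ rm0.
    by rewrite lt_eqF//; exact: lt_le_trans (sr _ r1) sm0.
- split.
    apply: (@profile_nonincreasing _ _ _ _ [::] N mrho N1).
    + by move=> xi xiN; apply: rho_l; exact: le_trans N2.
    + by move=> xi xiN; apply: rho_r; exact: le_trans xiN.
    + by move=> xi _; exact: crho.
  apply: (@profile_homo _ _ _ _ [::] N _ N1).
  + move=> x y /mrho; rewrite /= le_eqVlt => /predU1P[->//|lt].
    by apply: ltW; apply: (Blt _ _ _ lt).1; have /andP[+ _] := rho_in y; exact: le_trans.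
  + by move=> xi xiN /=; rewrite rho_l ?(le_trans xiN).
  + by move=> xi xiN /=; rewrite rho_r ?(le_trans _ xiN).
  + by move=> xi _; exact: cLr.
- split; [| |exact: crho|exact: cLr] => xi.
    apply/Bc; have /andP[r1 r2] := rho_in xi.
    by rewrite (le_trans hr)// (le_trans r2)// ltW.
  by move=> xi0; rewrite rho_r// (le_trans sm0).
Unshelve. all: end_near. Qed.

End Waves.

(** * Construction of a solution, and the structure of an arbitrary one *)

Section Solution.
Variable R : realType.
Variable p : R -> R.
Hypothesis pp : pressure p.
Local Notation mu := (@lebesgue_measure R).
Local Notation state := (R * R)%type.

Lemma cvg_components (T : Type) (F : set_system T) (f : T -> state) (l : state) :
  Filter F -> (fun x => (f x).1) @ F --> l.1 -> (fun x => (f x).2) @ F --> l.2 ->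
  f @ F --> l.
Proof.
move=> FF f1 f2; rewrite (_ : f = fun x => ((f x).1, (f x).2)); last first.
  by apply/funext => x; rewrite [LHS]surjective_pairing.
rewrite [l]surjective_pairing.
exact: (@cvg_pair _ _ _ F (nbhs l.1) (nbhs l.2)).
Qed.

Lemma self_similar_BV U (A B t : R) : profile U A B ->
  BV_line (self_similar U A B t).
Proof.
move=> pU; rewrite /self_similar.
have [t0|t0] := ltP 0 t; first exact: profile_BV pU.
have := profile_BV ltr01 (profile_step 0 A B).
by under eq_fun do rewrite divr1.
Qed.

Section Construction.
Variables (al ar : R) (ul ur um up : state) (wl wr : R -> state).
Variables (a b c d : R).
Hypotheses (wavel : lax_wave1 p ul um wl) (waver : lax_wave2 p up ur wr).
Hypotheses (b0 : b <= 0) (c0 : 0 <= c).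
Hypothesis Tl1 : transition (fst \o wl) (snd \o wl) ul.1 ul.2 um.1 um.2 a b.
Hypothesis Tl2 : transition (snd \o wl) (flow p \o wl)
  ul.2 (flow p ul) um.2 (flow p um) a b.
Hypothesis Tr1 : transition (fst \o wr) (snd \o wr) up.1 up.2 ur.1 ur.2 c d.
Hypothesis Tr2 : transition (snd \o wr) (flow p \o wr)
  up.2 (flow p up) ur.2 (flow p ur) c d.
Hypotheses (pl1 : profile (fst \o wl) ul.1 um.1) (pl2 : profile (snd \o wl) ul.2 um.2).
Hypotheses (pr1 : profile (fst \o wr) up.1 ur.1) (pr2 : profile (snd \o wr) up.2 ur.2).
Hypotheses (Al : forall xi, A0_closed p (wl xi)) (Ar : forall xi, A0_closed p (wr xi)).
Hypotheses (wl0 : forall xi, 0 <= xi -> wl xi = um) (wr0 : forall xi, xi <= 0 -> wr xi = up).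
Hypotheses (cl1 : {for 0, continuous (fst \o wl)}) (cl2 : {for 0, continuous (snd \o wl)}).
Hypotheses (cr1 : {for 0, continuous (fst \o wr)}) (cr2 : {for 0, continuous (snd \o wr)}).
Hypotheses (Aul : A0 p ul) (Aur : A0 p ur).
Hypothesis balance : al * um.2 = ar * up.2 /\ flow p um = flow p up.

Let W (xi : R) : state := if xi < 0 then wl xi else wr xi.

Definition junction_solution (t x : R) : state :=
  (self_similar (fun xi => (W xi).1) ul.1 ur.1 t x,
   self_similar (fun xi => (W xi).2) ul.2 ur.2 t x).
Local Notation u := junction_solution.

Let uW t x : 0 < t -> u t x = W (x / t).
Proof. by move=> t0; rewrite /u /self_similar t0 [RHS]surjective_pairing. Qed.

Let u0 x : u 0 x = riemann_datum ul ur x.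
Proof.
rewrite /u /self_similar ltxx /riemann_datum.
by case: ifP => _; rewrite [RHS]surjective_pairing.
Qed.

(** On each side of 0 one of the two waves is constant, so the glued profile is the sum of both
    minus a step, and the monotone decompositions simply add up. *)
Let profile_glue (h : state -> R) : profile (h \o wl) (h ul) (h um) ->
  profile (h \o wr) (h up) (h ur) -> profile (h \o W) (h ul) (h ur).
Proof.
move=> p1 p2.
have := profileD p1 (profileD p2 (profileN (profile_step 0 (h up) (h um)))).
rewrite subrr addr0 addrCA subrr addr0; apply: profile_ext => xi /=.
rewrite /W; case: ltP => xi0; first by rewrite wr0 ?ltW// subrr addr0.
by rewrite wl0// addrCA subrr addr0.
Qed.

Let pW1 : profile (fun xi => (W xi).1) ul.1 ur.1.
Proof. exact: (profile_glue pl1 pr1). Qed.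

Let pW2 : profile (fun xi => (W xi).2) ul.2 ur.2.
Proof. exact: (profile_glue pl2 pr2). Qed.

Let AW xi : A0_closed p (W xi).
Proof. by rewrite /W; case: ifP => _; [exact: Al|exact: Ar]. Qed.

Let Au t x : A0_closed p (u t x).
Proof.
have [t0|t0] := boolP (0 < t); first by rewrite uW//; exact: AW.
rewrite /u /self_similar (negbTE t0).
by case: ifP => _; apply: A0_closedW; [case: ul Aul|case: ur Aur].
Qed.

Let weakW (h k : state -> R) (phi : R * R -> R) :
  transition (h \o wl) (k \o wl) (h ul) (k ul) (h um) (k um) a b ->
  transition (h \o wr) (k \o wr) (h up) (k up) (h ur) (k ur) c d ->
  test_function phi -> forall N0 : R, exists2 N, N0 <= N &
    exists g g', sector phi (h \o W) (k \o W) (- N) N g g'.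
Proof.
move=> T1 T2 tphi N0; pose N := Num.max N0 (Num.max 0 (Num.max (- a) d)).
have [N1 N2 N3 N4] : [/\ N0 <= N, 0 <= N, - a <= N & d <= N].
  by rewrite !le_max !lexx !orbT.
exists N => //.
have S1 := transition_sector tphi T1 (c := - N) (d := 0).
have S2 := transition_sector tphi T2 (c := 0) (d := N).
have {}S1 : sector phi (h \o W) (k \o W) (- N) 0 (k ul - - N * h ul) (k um - 0 * h um).
  apply: (@sector_ext _ _ _ _ (h \o wl) (k \o wl)) => [xi /andP[_ xi0]|].
    by rewrite /= /W xi0.
  by apply: S1 => //; rewrite lerNl.
have {}S2 : sector phi (h \o W) (k \o W) 0 N (k up - 0 * h up) (k ur - N * h ur).
  apply: (@sector_ext _ _ _ _ (h \o wr) (k \o wr)) => [xi /andP[xi0 _]|].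
    by rewrite /= /W ltNge (ltW xi0).
  exact: S2.
exists (k ul - - N * h ul), (k ur - N * h ur).
have S1' := sector_axisr tphi (k up - 0 * h up) S1.
by apply: (@sector_glue _ _ _ _ (- N) 0 N) S1' S2; rewrite // oppr_le0.
Qed.

Let trace_l t : 0 < t -> u t @ (0 : R)^'- --> um.
Proof.
move=> t0; apply: (@cvg_trans _ ((fun x => wl (x / t)) @ (0 : R)^'-)).
  apply: near_eq_cvg; near=> x; have x0 : x < 0 by near: x; exact: nbhs_left_lt.
  by rewrite uW// /W ltr_pdivrMr// mul0r x0.
have hcv (h : state -> R) : {for 0, continuous (h \o wl)} ->
    (fun x => h (wl (x / t))) @ (0 : R)^'- --> h um.
  move=> ch; apply: cvg_at_left_filter.
  have -> : h um = (h \o wl) ((0 : R) / t) by rewrite /= mul0r wl0.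
  apply: (@continuous_comp _ _ _ (fun x : R => x / t) (h \o wl)).
    by apply: cvgM; [exact: cvg_id|exact: cvg_cst].
  by rewrite mul0r.
by apply: cvg_components; [exact: (hcv fst)|exact: (hcv snd)].
Unshelve. all: end_near. Qed.

Let trace_r t : 0 < t -> u t @ (0 : R)^'+ --> up.
Proof.
move=> t0; apply: (@cvg_trans _ ((fun x => wr (x / t)) @ (0 : R)^'+)).
  apply: near_eq_cvg; near=> x; have x0 : 0 < x by near: x; exact: nbhs_right_gt.
  by rewrite uW// /W ltr_pdivrMr// mul0r ltNge (ltW x0).
have hcv (h : state -> R) : {for 0, continuous (h \o wr)} ->
    (fun x => h (wr (x / t))) @ (0 : R)^'+ --> h up.
  move=> ch; apply: cvg_at_right_filter.
  have -> : h up = (h \o wr) ((0 : R) / t) by rewrite /= mul0r wr0.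
  apply: (@continuous_comp _ _ _ (fun x : R => x / t) (h \o wr)).
    by apply: cvgM; [exact: cvg_id|exact: cvg_cst].
  by rewrite mul0r.
by apply: cvg_components; [exact: (hcv fst)|exact: (hcv snd)].
Unshelve. all: end_near. Qed.

Let ae_pos (P : R -> Prop) : (forall t, 0 < t -> P t) ->
  {ae mu, forall t, 0 <= t -> P t}.
Proof.
move=> HP; apply: (@ae_off_seq _ [:: 0]) => t; rewrite inE => t0 t0'.
by apply: HP; rewrite lt_neqAle eq_sym t0.
Qed.

Lemma junction_solutionP :
  subsonic_P_solution p al ar ul ur u.
Proof.
split.
- split.
  + apply: self_similar_C0 pW1 pW2 _ => t x.
    by have [] := Au t x.
  + by apply/aeW => t _; split; apply: self_similar_BV; [exact: pW1|exact: pW2].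
  + move=> phi tphi; split.
      apply: (@weak_identity _ _ tphi (fst \o W) (snd \o W)
        (fun t x => (u t x).1) (fun t x => (u t x).2)).
        exact: weakW Tl1 Tr1 tphi.
      by move=> t x t0; rewrite uW.
    apply: (@weak_identity _ _ tphi (snd \o W) (flow p \o W)
      (fun t x => (u t x).2) (fun t x => flow p (u t x))).
      exact: weakW Tl2 Tr2 tphi.
    by move=> t x t0; rewrite uW.
  + by apply/aeW => x; exact: u0.
  + apply: ae_pos => t t0; exists um, up; split.
    * exact: trace_l.
    * exact: trace_r.
    * by rewrite /Phi_P; have [-> ->] := balance; rewrite !subrr.
- exists um, up, wl, wr; split => //.
    by apply: ae_pos => t t0; split; [exact: trace_l|exact: trace_r].
  move=> t t0; apply: (@ae_off_seq _ [:: 0]) => x _; rewrite uW// /W.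
  split=> x0; first by rewrite ltr_pdivrMr// mul0r x0.
  by rewrite ltr_pdivrMr// mul0r ltNge (ltW x0).
- by move=> t _; apply/aeW => x; exact: Au.
Qed.

End Construction.

(** A condition valid almost everywhere reaches a one-sided limit because every one-sided
    neighbourhood meets every set of full measure, which is the hypothesis on [F]. Positive density
    at the limit makes both eigenvalues continuous there. *)
Lemma trace_closed (F : set_system R) (f : R -> state) (v : state) :
  Filter F ->
  (forall P Q : R -> Prop, (\forall x \near F, P x) -> {ae mu, forall x, Q x} ->
     exists x, P x /\ Q x) ->
  {ae mu, forall x, A0_closed p (f x)} -> f @ F --> v -> 0 < v.1 ->
  A0_closed p v.
Proof.
move=> FF meet Af fv v0.
have c1 : {for v, continuous (lambda1 p)}.
  apply: cvgB.
    apply: cvgM; first exact: cvg_snd.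
    by apply: cvgV; [rewrite gt_eqF|exact: cvg_fst].
  apply: (@continuous_comp _ _ _ fst (sound p)); first exact: cvg_fst.
  exact: (sound_cts pp).
have c2 : {for v, continuous (lambda2 p)}.
  apply: cvgD.
    apply: cvgM; first exact: cvg_snd.
    by apply: cvgV; [rewrite gt_eqF|exact: cvg_fst].
  apply: (@continuous_comp _ _ _ fst (sound p)); first exact: cvg_fst.
  exact: (sound_cts pp).
have f1 : (fun x => lambda1 p (f x)) @ F --> lambda1 p v := cvg_comp _ _ fv c1.
have f2 : (fun x => lambda2 p (f x)) @ F --> lambda2 p v := cvg_comp _ _ fv c2.
split => //; rewrite leNgt; apply/negP => lt.
  have N : \forall x \near F, 0 < lambda1 p (f x).
    exact: (cvgr_gt _ f1).
  by have [x [+ [_ + _]]] := meet _ _ N Af; rewrite ltNge => /negP.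
have N : \forall x \near F, lambda2 p (f x) < 0.
  exact: (cvgr_lt _ f2).
by have [x [+ [_ _ +]]] := meet _ _ N Af; rewrite ltNge => /negP.
Qed.

Lemma meet_left (P Q : R -> Prop) : (\forall x \near (0 : R)^'-, P x) ->
  {ae mu, forall x, Q x} -> exists x, P x /\ Q x.
Proof.
move=> /nbhs_ballP[e /= e0 eP] aQ.
have e0' : - e < 0 by rewrite oppr_lt0.
have [x /andP[ex x0] Qx] := ae_itvoo e0' aQ.
exists x; split => //; apply: eP => //=.
by rewrite /ball/= sub0r normrN ltr0_norm// ltrNl.
Qed.

Lemma meet_right (P Q : R -> Prop) : (\forall x \near (0 : R)^'+, P x) ->
  {ae mu, forall x, Q x} -> exists x, P x /\ Q x.
Proof.
move=> /nbhs_ballP[e /= e0 eP] aQ.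
have [x /andP[ex x0] Qx] := ae_itvoo e0 aQ.
exists x; split => //; apply: eP => //=.
by rewrite /ball/= sub0r normrN gtr0_norm.
Qed.

(** The junction condition speaks of traces at almost every time, the wave structure of fixed states
    [um] and [up]. One time at which both hold identifies the two, since limits are unique. *)
Lemma solution_states (al ar : R) (ul ur : state) v :
  subsonic_P_solution p al ar ul ur v ->
  exists (um up : state) (wl wr : R -> state),
  [/\ lax_wave1 p ul um wl /\ lax_wave2 p up ur wr,
      A0_closed p um /\ A0_closed p up,
      al * um.2 = ar * up.2 /\ flow p um = flow p up &
      forall t : R, 0 < t -> {ae mu, forall x, (x < 0 -> v t x = wl (x / t)) /\
                                (0 < x -> v t x = wr (x / t))}].
Proof.
move=> [[_ _ _ _ tr1] [um [up [wl [wr [W1 W2 tr2 vw]]]]] Av].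
exists um, up, wl, wr.
have [t /andP[t0 _] [T1 T2]] := ae_itvoo ltr01 (ae_imply2 (fun x P Q => conj P Q) tr1 tr2).
have [um' [up' [l1 r1 E]]] := T1 (ltW t0).
have [l2 r2] := T2 (ltW t0).
have HR : hausdorff_space state by exact: norm_hausdorff.
have Em : um' = um by apply: (cvg_unique HR l1 l2).
have Ep : up' = up by apply: (cvg_unique HR r1 r2).
have m0 : 0 < um.1 by case: W1.
have p0 : 0 < up.1 by case: W2.
have Fl : Filter (0 : R)^'- by exact: filter_filter.
have Fr : Filter (0 : R)^'+ by exact: filter_filter.
have Am := trace_closed Fl (@meet_left) (Av t (ltW t0)) l2 m0.
have Ap := trace_closed Fr (@meet_right) (Av t (ltW t0)) r2 p0.
split => //.
move: E; rewrite Em Ep /Phi_P => -[/eqP + /eqP].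
by rewrite !subr_eq0 => /eqP -> /eqP ->.
Qed.

End Solution.

Theorem theorem2p8 (R : realType) (p : R -> R)
    (hatl checkl hatr checkr : R * R -> R)
    (al ar : R) (ul ur : R * R) (g : R -> R) :
  pressure p ->
  sonic_densities p hatl checkl hatr checkr ->
  0 < al -> 0 < ar ->
  A0 p ul -> A0 p ur ->
  inverse_L2rev p ur g ->
  let l1 := inf [set rho : R | hatl ul <= rho <= checkl ul /\
                   al * L1 p rho ul <= ar * L2rev p (hatr ur) ur] in
  let l2 := sup [set rho : R | hatl ul <= rho <= checkl ul /\
                   al * L1 p rho ul >= ar * L2rev p (checkr ur) ur] in
  (flow p (l1, L1 p l1 ul)
     - flow p (g (al / ar * L1 p l1 ul), al / ar * L1 p l1 ul) <= 0 /\
   flow p (l2, L1 p l2 ul)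
     - flow p (g (al / ar * L1 p l2 ul), al / ar * L1 p l2 ul) >= 0)
  <->
  (exists u : R -> R -> R * R,
     subsonic_P_solution p al ar ul ur u /\
     forall v : R -> R -> R * R,
       subsonic_P_solution p al ar ul ur v -> same_solution u v).
Proof.
move=> pp sonic al0 ar0 Aul Aur gP l1 l2.
have [sl sr] := sonic_densities_L1 sonic.
have Aur' : A0 p (mirror ur) by apply/A0_mirror.
have [hl0 hlu ukl _ _] := branch_ends pp sl Aul.
have Bl := branch_closed pp sl Aul; have Ll := branch_lt pp sl Aul.
have [hr0 hru ukr _ _] := branch_ends pp sr Aur'.
have Br := branch_closed pp sr Aur'; have Lr := branch_lt pp sr Aur'.
have Qh := branch_hat_gt0 pp sl Aul; have Qk := branch_check_lt0 pp sl Aul.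
have Sh := branch_hat_gt0 pp sr Aur'; have Sk := branch_check_lt0 pp sr Aur'.
rewrite /= !mirrorK in hr0 hru ukr Br Lr Sh Sk.
set hl := hatl ul in hl0 hlu ukl Bl Ll Qh *.
set kl := checkl ul in ukl Bl Qk *.
(* On the reversed curve momentum increases, so the lower sonic end is the zero of [lambda2] and the
   upper one the zero of [lambda1]. *)
set hr := checkr ur in hr0 hru Br Lr Sh *.
set kr := hatr ur in ukr Br Sk *.
pose Q r := L1 p r ul; pose S r := L2rev p r ur.
pose fl r := flow p (r, Q r).
have SE r : S r = - L1 p r (mirror ur) by rewrite /S L2rev_mirror.
have SM r : (r, S r) = mirror (r, L1 p r (mirror ur)) by rewrite SE.
have hkl : hl <= kl by rewrite ltW// (lt_trans hlu).
have hkr : hr <= kr by rewrite ltW// (lt_trans hru).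
have Qc : {within `[hl, kl], continuous Q}.
  by apply: within_itvcc => x /andP[+ _] => /(lt_le_trans hl0)/(branch_cts pp Aul)[].
have flc : {within `[hl, kl], continuous fl}.
  by apply: within_itvcc => x /andP[+ _] => /(lt_le_trans hl0)/(branch_cts pp Aul)[].
have Sc : {within `[hr, kr], continuous S}.
  apply: within_itvcc => x /andP[+ _] => /(lt_le_trans hr0)/(branch_cts pp Aur')[H _].
  by rewrite (_ : S = fun r => - L1 p r (mirror ur)); [apply: cvgN|exact/funext].
have frc : {within `[hr, kr], continuous (fun r => flow p (r, S r))}.
  apply: within_itvcc => x /andP[+ _] => /(lt_le_trans hr0)/(branch_cts pp Aur')[_ H].
  rewrite (_ : (fun r => _) = fun r => flow p (r, L1 p r (mirror ur)))//.
  by apply/funext => r; rewrite SM flow_mirror.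
have Qd r s : hl <= r -> r < s -> s <= kl -> Q s < Q r.
  by move=> hr' rs _; have [] := Ll r s hr' rs.
have fli r s : hl <= r -> r < s -> s <= kl -> fl r < fl s.
  by move=> hr' rs _; have [] := Ll r s hr' rs.
have Si r s : hr <= r -> r < s -> s <= kr -> S r < S s.
  by move=> hr' rs _; rewrite !SE ltrN2; have [] := Lr r s hr' rs.
have fri r s : hr <= r -> r < s -> s <= kr -> flow p (r, S r) < flow p (s, S s).
  by move=> hr' rs _; rewrite !SM !flow_mirror; have [] := Lr r s hr' rs.
have Sh0 : S hr < 0 by rewrite SE oppr_lt0.
have Sk0 : 0 < S kr by rewrite SE oppr_gt0.
have Sclosed r : A0_closed p (r, S r) <-> hr <= r <= kr.
  by rewrite SM; split=> [/A0_closed_mirror/Br|/Br/A0_closed_mirror].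
have gS r : hr <= r <= kr -> g (S r) = r by move=> /Sclosed; exact: gP.
have BP := balancedP (fr := fun r q => flow p (r, q)) al0 ar0 hkl hkr Qc Sc flc frc
  Qd Si fli fri Qh Qk Sh0 Sk0 gS.
apply: (iff_trans BP).
have U := balanced_uniq (fr := fun r q => flow p (r, q)) al0 ar0 Qd Si fli fri.
have states (um up : R * R) wl wr : lax_wave1 p ul um wl /\ lax_wave2 p up ur wr ->
    A0_closed p um /\ A0_closed p up ->
    al * um.2 = ar * up.2 /\ flow p um = flow p up ->
    [/\ um = (um.1, Q um.1), up = (up.1, S up.1) &
       balanced Q S fl (fun r q => flow p (r, q)) hl kl hr kr al ar um.1 up.1].
  move=> [[_ Em _] [_ Ep _]] [Am Ap] [E F].
  have um2 : um = (um.1, Q um.1) by rewrite [LHS]surjective_pairing Em.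
  have up2 : up = (up.1, S up.1) by rewrite [LHS]surjective_pairing Ep.
  split => //; split.
  - by apply/Bl; rewrite -/(Q um.1) -um2.
  - by apply/Sclosed; rewrite -up2.
  - by rewrite /Q /S -Em -Ep.
  - by rewrite /fl -um2 -up2.
have uniq v v' : subsonic_P_solution p al ar ul ur v ->
    subsonic_P_solution p al ar ul ur v' -> same_solution v v'.
  (* At [t = 0] the wave structure says nothing and the initial datum is used; at positive times it
     says nothing at [x = 0], a null set. *)
  move=> s s' t; rewrite le_eqVlt => /predU1P[<-|t0].
    have [[_ _ _ i _] _ _] := s; have [[_ _ _ i' _] _ _] := s'.
    by apply: ae_imply2 i i' => x -> ->.
  have [um [up [wl [wr [W A E H]]]]] := solution_states pp s.
  have [um' [up' [wl' [wr' [W' A' E' H']]]]] := solution_states pp s'.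
  have [Em Ep B] := states _ _ _ _ W A E.
  have [Em' Ep' B'] := states _ _ _ _ W' A' E'.
  have [um1 up1] := U _ _ _ _ B B'.
  have umE : um' = um by rewrite Em Em' um1.
  have upE : up' = up by rewrite Ep Ep' up1.
  rewrite umE upE in W'.
  have [[W1 /wave2_mirror W2] [W1' /wave2_mirror W2']] := (W, W').
  have wlE : wl =1 wl' by apply: (wave1_uniq pp (cl := false) _ W1 W1'); case: Aul.
  have wrE xi : wr xi = wr' xi.
    apply: (can_inj (@mirrorK R)); rewrite -[xi]opprK.
    by apply: (wave1_uniq pp _ W2 W2'); case: Aur'.
  have nz : {ae (@lebesgue_measure R), forall x, x != 0}.
    by apply: (@ae_off_seq _ [:: 0]) => x; rewrite inE.
  apply: ae_imply2 (H t t0) (ae_imply2 (fun x P Q => conj P Q) (H' t t0) nz).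
  move=> x [h1 h2] [[h1' h2'] x0]; have := x0; rewrite neq_lt => /orP[xn|xp].
    by rewrite h1// h1'// wlE.
  by rewrite h2// h2'// wrE.
split; last first.
  move=> [u [/(solution_states pp)[um [up [wl [wr [W A E _]]]]] _]].
  by have [_ _ B] := states _ _ _ _ W A E; exists um.1, up.1.
move=> [rl [rr B]].
have [rlin rrin Eq Ef] := B.
(* The right wave is built as a 1-wave from the mirrored right datum and reflected back, hence the
   definition of [up] through [mirror]. *)
pose um := (rl, L1 p rl ul); pose up := mirror (rr, L1 p rr (mirror ur)).
have [wl [a [b [W1 b0 [T1 T2] [P1 P2] [Al wl0 cl1 cl2]]]]] :=
  wave1_exists pp sl false Aul rlin (erefl um).
have upE : mirror up = (rr, L1 p rr (mirror ur)) by rewrite mirrorK.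
have rrin' : (checkr \o @mirror R) (mirror ur) <= rr <= (hatr \o @mirror R) (mirror ur).
  by rewrite /= !mirrorK.
have [w [c [d [W2 d0 [T3 T4] [P3 P4] [Aw w0 cw1 cw2]]]]] :=
  wave1_exists pp sr true Aur' rrin' upE.
pose wr xi := mirror (w (- xi)).
have W2' : lax_wave2 p up ur wr.
  apply/wave2_mirror.
  rewrite (_ : (fun xi => mirror (wr (- xi))) = w)//.
  by apply/funext => xi; rewrite /wr opprK mirrorK.
have E1 : (fun xi => 1 * (fst \o w) (- xi)) = fst \o wr.
  by apply/funext => xi; rewrite /= mul1r.
have E2 : (fun xi => - 1 * (snd \o w) (- xi)) = snd \o wr.
  by apply/funext => xi; rewrite /= mulN1r.
have E3 : (fun xi => - - 1 * (flow p \o w) (- xi)) = flow p \o wr.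
  by apply/funext => xi; rewrite /= opprK mul1r /wr flow_mirror.
have T3' : transition (fst \o wr) (snd \o wr) up.1 up.2 ur.1 ur.2 (- d) (- c).
  have := transition_mirror 1 T3; rewrite E1 E2 !mul1r !mulN1r /= !opprK; exact.
have T4' : transition (snd \o wr) (flow p \o wr)
    up.2 (flow p up) ur.2 (flow p ur) (- d) (- c).
  have := transition_mirror (- 1) T4.
  by rewrite E2 E3 opprK !mul1r !mulN1r !flow_mirror /= !opprK; exact.
have copp (h : R * R -> R) : {for 0, continuous (h \o w)} ->
    {for 0, continuous (fun xi : R => h (w (- xi)))}.
  move=> ch; apply: (@continuous_comp _ _ _ (fun xi : R => - xi) (h \o w)).
    by apply: cvgN; exact: cvg_id.
  by rewrite oppr0.
have bal : al * um.2 = ar * up.2 /\ flow p um = flow p up.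
  by split; [rewrite /= -SE; exact: Eq|rewrite /up -SM; exact: Ef].
pose u := junction_solution ul ur wl wr.
have uP : subsonic_P_solution p al ar ul ur u.
  have nc0 : 0 <= - d by rewrite oppr_ge0.
  have P4' : profile (snd \o wr) up.2 ur.2.
    by have := profileN (profile_mirror P4); rewrite /= !opprK; exact.
  have Ar xi : A0_closed p (wr xi) by apply/A0_closed_mirror; exact: Aw.
  have wr0 xi : xi <= 0 -> wr xi = up by move=> xi0; rewrite /wr w0 ?mirrorK ?oppr_ge0.
  have cwr2 : {for 0, continuous (snd \o wr)} by apply: cvgN; exact: copp cw2.
  exact: (junction_solutionP W1 W2' b0 nc0 T1 T2 T3' T4' P1 P2
    (profile_mirror P3) P4' Al Ar wl0 wr0 cl1 cl2 (copp _ cw1) cwr2 Aul Aur bal).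
exists u; split; [exact: uP|move=> v; exact: uniq].
Qed.
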